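(* Let $G$ be a torsion-free abelian, countable infinite discrete group acting by homeomorphisms on a compact Hausdorff space $X$. Then the action $G\curvearrowright X$ is free if and only if every closed ideal of $\ell^1(G\curvearrowright X)$ is self-adjoint.
   Context: Write $\sigma_s:X\to X$ for the homeomorphism given by $s\in G$, $e$ for the identity of $G$, and $C(X)$ for the continuous functions $X\to\mathbb{C}$ with the supremum norm $\|\cdot\|_\infty$. Set $\alpha_s(f)(x)=f(\sigma_s^{-1}(x))$ for $s\in G$, $f\in C(X)$, $x\in X$. $\ell^1(G\curvearrowright X)$ is the Banach $*$-algebra of all functions $f:G\to C(X)$ with $\|f\|=\sum_{s\in G}\|f(s)\|_\infty<\infty$, with pointwise linear operations, product $(fg)(s)=\sum_{t\in G}f(t)\,\alpha_t(g(t^{-1}s))$ and involution $(f^* )(s)=\alpha_s(\overline{f(s^{-1})})$. ''Ideal'' means two-sided ideal. An ideal $I$ is self-adjoint if $f^*\in I$ for every $f\in I$. The action is free if for every $s\in G\setminus\{e\}$ and every $x\in X$ one has $\sigma_s(x)\neq x$. *)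

(* Defs.v *)
From HB Require Import structures.
From mathcomp Require Import all_boot all_order all_algebra finmap.
From mathcomp Require Import all_classical all_reals all_analysis.
From mathcomp.analysis.showcase Require Import summability.
From mathcomp Require Import complex.

Set Implicit Arguments.
Unset Strict Implicit.
Unset Printing Implicit Defensive.

Import Order.TTheory GRing.Theory Num.Theory.
Import numFieldTopology.Exports numFieldNormedType.Exports.

Local Open Scope classical_set_scope.
Local Open Scope ring_scope.

(* [R[i]] is seen through its [numClosedFieldType] structure, from which it gets
   the topology and the uniformity induced by the modulus. *)
Definition Cplx (R : realType) : numClosedFieldType := R[i].

Section Group.
Variable G : groupType.

Definition abelian_group := forall s t : G, commute s t.

Definition torsion_free :=
  forall (s : G) (n : nat), (0 < n)%N -> (s ^+ n = 1)%g -> s = 1%g.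

End Group.

Section CrossedProduct.
Variables (R : realType) (G : groupType) (X : topologicalType).
Variable sigma : G -> X -> X.

Local Notation C := (Cplx R).

(* The inverse of [sigma s] is [sigma s^-1], so that each [sigma s] is a
   homeomorphism. *)
Record acts_by_homeomorphisms : Prop := ActsByHomeomorphisms {
  act_continuous : forall s, continuous (sigma s);
  act_1 : forall x, sigma 1%g x = x;
  act_M : forall s t x, sigma (s * t)%g x = sigma s (sigma t x) }.

Definition free_action :=
  forall s : G, s <> 1%g -> forall x : X, sigma s x <> x.

Definition translate (s : G) (h : X -> C) : X -> C :=
  fun x => h (sigma s^-1%g x).

(* The norm of [R[i]] takes its values on the nonnegative real axis of [R[i]],
   hence the real part. For [X] empty this is [sup set0 = 0]. *)
Definition sup_norm (h : X -> C) : R :=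
  sup [set complex.Re `|h x| | x in [set: X]].

Definition l1_norm (f : G -> X -> C) : \bar R :=
  \esum_(s in [set: G]) (sup_norm (f s))%:E.

Definition ell1 : set (G -> X -> C) :=
  [set f | (forall s, continuous (f s)) /\ (l1_norm f < +oo)%E].

(* Sum of a family in C(X) for the supremum norm: the uniform limit of the net of
   sums over the finite subsets of [G] (and 0 when that net does not converge,
   which does not happen in [l1_mul f g] for [f] and [g] in [ell1]). *)
Definition uniform_sum (u : G -> X -> C) : X -> C :=
  xget (fun=> 0) [set h | {uniform, partial_sum u @ totally --> h}].

Definition l1_mul (f g : G -> X -> C) : G -> X -> C :=
  fun s => uniform_sum (fun t x => f t x * translate t (g (t^-1 * s)%g) x).

Definition l1_star (f : G -> X -> C) : G -> X -> C :=
  fun s => translate s (fun x => (f s^-1%g x)^*).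

Record ideal (I : set (G -> X -> C)) : Prop := Ideal {
  ideal_sub : I `<=` ell1;
  ideal_0 : I (fun _ _ => 0);
  ideal_D : forall f g, I f -> I g -> I (fun s x => f s x + g s x);
  ideal_Z : forall (a : C) f, I f -> I (fun s x => a * f s x);
  ideal_Ml : forall f g, ell1 f -> I g -> I (l1_mul f g);
  ideal_Mr : forall f g, I f -> ell1 g -> I (l1_mul f g) }.

Definition l1_closed (I : set (G -> X -> C)) :=
  forall f, ell1 f ->
    (forall e : R, 0 < e ->
      exists2 g, I g & (l1_norm (fun s x => (f s x - g s x)%R) < e%:E)%E) ->
    I f.

Definition self_adjoint (I : set (G -> X -> C)) :=
  forall f, I f -> I (l1_star f).

End CrossedProduct.

(* Main.v *)
Require Import Defs.
From mathcomp Require Import all_boot all_order all_algebra.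
From mathcomp Require Import finmap.
From mathcomp Require Import all_classical all_reals all_analysis.
From mathcomp.analysis.showcase Require Import summability.
From mathcomp Require Import complex ring lra zify.

(* When the action is free, let a be in a closed ideal. For a finite set F of
   nontrivial group elements there is a partition of unity (phi_i^2) with
   phi_i * alpha_s(phi_i) = 0 for s in F; then sum_i phi_i a phi_i has the same
   coefficient as a at e and vanishes on F, so that a(e), and hence every coefficient
   of a, is in the ideal. In C(X) closed ideals are stable under conjugation, because
   conj(h) is a limit of conj(h)^2 h / (|h|^2 + eps^2).

   When s <> e fixes x0, consider bounded even functions T_J : Z -> C of finite
   support, and the elements a with sum_n T_J(n) a(r s^n)(sigma_t x0) -> 0 uniformly
   in r and t. They form a closed ideal since G is abelian. It is not self-adjoint if
   some f in l^1(Z) satisfies sum_n f(n+k) T_J(n) -> 0 uniformly in k but not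
   sum_n conj(f(n)) T_J(n) -> 0. This is Malliavin's failure of spectral synthesis:
   f = f1 + i f2 with f1 and f2 real, T_J approximates the derivative
   d = d1 + i d2 of the Dirac mass at the origin in the plane, pulled back by
   (f1, f2); indeed d(x + i y) = 0 while d(x - i y) = 2.

   The functions f1, f2 live on the set of the sums of theta_k in {0, 2pi/3^(k^2+1),
   -2pi/3^(k^2+1)}: there f1 is a series of independent signs with coefficients gamma_k,
   which are + on theta_k <> 0 and - on theta_k = 0, each 2^-j being repeated
   often enough for the law of the series to have a smooth density, and the derivative
   at the origin is taken as a finite difference. *)

Set Implicit Arguments.
Unset Strict Implicit.
Unset Printing Implicit Defensive.

Import Order.TTheory GRing.Theory Num.Theory.
Import numFieldTopology.Exports numFieldNormedType.Exports.

Local Open Scope classical_set_scope.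
Local Open Scope ring_scope.

(** * A trigonometric series of independent signs *)

(** The difficulty is to have f absolutely summable on Z and T_J bounded on Z uniformly in J. A sign
    is a trigonometric polynomial in theta only as long as the later theta_j are ignored; each later
    theta_j forces a correction of relative size O(3^-j), since the exponents k^2 leave growing gaps
    between consecutive frequencies, and these corrections are summable. The coefficient of T_J at m
    comes from the law of the signs by inserting factors cos(m theta_k), real because theta_k takes
    symmetric values; the bound on the Fourier transform of this law holds for arbitrary factors in
    [-1, 1], hence uniformly in m. In the plane, T_J lives on four points around the origin, where
    f1 and f2 take values +h or -h; multiplying by them exchanges sums and differences exactly. One
    of the two combinations to be killed thus cancels identically, and the other retains two
    differences and is of lower order. T_J is even because the involution of the algebra reflects Z,
    so that only the conjugation of f matters. A tent function finally cuts T_J down to finite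
    support. *)

Section Walk.
Variables (R : realType) (S : zmodType).
Implicit Types (h : S -> R) (v : nat -> S) (t : nat -> R) (z : S).

Fixpoint walkf h v t K z : R :=
  if K is k.+1 then (walkf h v t k (z + v k) + t k * walkf h v t k (z - v k)) / 2
  else h z.

(* For t = tc m, the m-th Fourier coefficient of the restriction to the event
   "the signs sum up to z" of the product of the laws of the theta_k: with
   probability 1/2, theta_k is 0 and has Fourier coefficient 1, and otherwise it is
   +-2pi/3^(k^2+1) and has Fourier coefficient t k. *)
Definition walk v t K z := walkf (fun z => (z == 0)%:R) v t K z.

Lemma walkS v t k z :
  walk v t k.+1 z = (walk v t k (z + v k) + t k * walk v t k (z - v k)) / 2.
Proof. by []. Qed.

Lemma eq_walk v t t' K z : (forall k, (k < K)%N -> t k = t' k) ->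
  walk v t K z = walk v t' K z.
Proof.
rewrite /walk; elim: K z => //= k IH z tt'.
have tt'k i : (i < k)%N -> t i = t' i by move=> ik; exact/tt'/ltnW.
by rewrite !IH// tt'.
Qed.

End Walk.

(** * Interpolation at three points, and multiplication by a sign *)

Section Frequencies.
Variable R : realType.

Definition freq (k : nat) : int := (3 ^ (k ^ 2))%N.

Definition angle (k : nat) (m : int) : R := 2 * pi * m%:~R / 3 ^+ (k ^ 2).+1.

Definition tc (m : int) (k : nat) : R := cos (angle k m).

Lemma angleD k m n : angle k (m + n) = angle k m + angle k n.
Proof. by rewrite /angle intrD mulrDr mulrDl. Qed.

Lemma angleN k m : angle k (- m) = - angle k m.
Proof. by rewrite /angle mulrNz mulrN mulNr. Qed.

Lemma angle0 k : angle k 0 = 0.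
Proof. by rewrite /angle mulr0 mul0r. Qed.

Lemma angle_freq k : angle k (freq k) = 2 * pi / 3.
Proof.
rewrite /angle /freq -pmulrn natrX exprS.
by field; rewrite expf_neq0// pnatr_eq0.
Qed.

Lemma tcN m k : tc (- m) k = tc m k.
Proof. by rewrite /tc angleN cosN. Qed.

Lemma tc0 k : tc 0 k = 1.
Proof. by rewrite /tc angle0 cos0. Qed.

Lemma norm_tc m k : `|tc m k| <= 1.
Proof. by rewrite ler_norml cos_geN1 cos_le1. Qed.

Lemma cosDpi2n (x : R) (n : nat) : cos (x + n%:R * (2 * pi)) = cos x.
Proof.
elim: n => [|n IH]; first by rewrite mul0r addr0.
rewrite -(IH) -[RHS]cosD2pi; congr cos.
by rewrite -natr1 mulr2n; ring.
Qed.

(** [freq k] is a multiple of 3^(j^2+1), because j^2 + 1 <= k^2: the earlier coordinates do not see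
    a shift by it. *)
Lemma tcD_freq m j k : (j < k)%N -> tc (m + freq k) j = tc m j.
Proof.
move=> jk; rewrite /tc angleD.
have jk2 : ((j ^ 2).+1 <= k ^ 2)%N.
  rewrite !expnS !expn0 !muln1; have := leq_mul jk jk; lia.
have -> : angle j (freq k) = ((3 ^ (k ^ 2 - (j ^ 2).+1))%N)%:R * (2 * pi).
  rewrite /angle /freq -pmulrn !natrX -[in X in _ * X / _](subnK jk2) exprD.
  by field; rewrite expf_neq0// pnatr_eq0.
exact: cosDpi2n.
Qed.

Lemma tcB_freq m j k : (j < k)%N -> tc (m - freq k) j = tc m j.
Proof. by move=> jk; rewrite -(tcD_freq (m - freq k) jk) subrK. Qed.

(** The triple angle formula makes this cosine a root of (c - 1)(2c + 1)^2, and strict monotonicity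
    on [0, pi] excludes c = 1. *)
Lemma cos_third : cos (2 * pi / 3 : R) = - 1 / 2.
Proof.
set c := cos _.
have h3 : cos ((2 * pi / 3) *+ 3 : R) = 1.
  rewrite (_ : _ *+ 3 = pi *+ 2); first by rewrite -[pi *+ 2]add0r cosD2pi cos0.
  by rewrite !mulr2n mulrS mulr2n; field.
have s2 := cos2Dsin2 (2 * pi / 3 : R); rewrite -/c in s2.
have c3 : 4 * c ^+ 3 - 3 * c = 1.
  rewrite mulrS cosD mulr2n cosD sinD -/c in h3.
  set s := sin _ in s2 h3.
  transitivity (c * (c * c - s * s) - s * (s * c + c * s) + 3 * c * (c ^+ 2 + s ^+ 2 - 1)).
    by ring.
  by rewrite s2 h3; ring.
have /eqP : (c - 1) * (2 * c + 1) ^+ 2 = 0.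
  have -> : (c - 1) * (2 * c + 1) ^+ 2 = 4 * c ^+ 3 - 3 * c - 1 by ring.
  by rewrite c3 subrr.
rewrite mulf_eq0 sqrf_eq0 => /orP[/eqP c1|/eqP]; last by lra.
have pi0 := @pi_gt0 R.
suff : c < 1 by rewrite -subr_lt0 c1 ltxx.
rewrite -(@cos0 R) ltr_cos ?in_itv/=; last 2 first.
- by apply/andP; split; lra.
- by apply/andP; split; lra.
by lra.
Qed.

Lemma sin_third2 : sin (2 * pi / 3 : R) ^+ 2 = 3 / 4.
Proof.
have := cos2Dsin2 (2 * pi / 3 : R); rewrite cos_third => h.
by apply: (addrI ((-1 / 2) ^+ 2)); rewrite h; field.
Qed.

(** The discrete Fourier coefficients on Z/3 of j |-> e^(-i j x), for j in {-1, 0, 1} and x =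
    [angle k n]: with these weights on the frequencies n + q [freq k], the dependence on theta_k
    disappears. *)
Definition pcoef (k : nat) (n q : int) : R :=
  (1 + 2 * cos (angle k n + q%:~R * (2 * pi / 3))) / 3.

Lemma pcoef_sum k n : pcoef k n 0 + pcoef k n 1 + pcoef k n (-1) = 1.
Proof.
rewrite /pcoef mul0r addr0 mul1r mulN1r cosD cosB cos_third.
by field.
Qed.

(** The interpolation identity at the two nonzero values of theta_k, averaged over their sign;
    [pcoef_sum] is the same identity at theta_k = 0. *)
Lemma pcoef_tc k n m :
  pcoef k n 0 * tc (n + m) k + pcoef k n 1 * tc (n + freq k + m) k
  + pcoef k n (-1) * tc (n - freq k + m) k = tc m k.
Proof.
rewrite /tc !angleD angleN angle_freq /pcoef mul0r addr0 mul1r mulN1r.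
have a2 := cos2Dsin2 (angle k n).
have s2 := sin_third2.
rewrite !(cosD _ (angle k m)) !cosD !sinD cosN sinN cos_third.
set ca := cos (angle k n) in a2 *; set sa := sin (angle k n) in a2 *.
set s := sin _ in s2 *; set cb := cos _; set sb := sin _.
transitivity (cb * (ca ^+ 2 + sa ^+ 2) + (s ^+ 2 - 3 / 4) *
   ((4 / 3) * sa ^+ 2 * cb + (4 / 3) * ca * sa * sb)); first by field.
by rewrite a2 s2; ring.
Qed.

Lemma cos_lipschitz (x y : R) : `|cos x - cos y| <= `|x - y|.
Proof.
wlog xy : x y / x <= y => [H|].
  by case/orP: (le_total x y) => /H//; rewrite distrC (distrC x).
rewrite distrC (distrC x).
have [z _ ->] := @MVT_segment R cos (fun z => - sin z) x y xy
  (fun z _ => is_derive_cos z) (continuous_subspaceT (@continuous_cos R)).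
by rewrite normrM normrN ler_piMl// sin_max.
Qed.

Lemma norm_sin_le (x : R) : `|sin x| <= `|x|.
Proof.
have := cos_lipschitz (x - pi / 2) (- (pi / 2)).
by rewrite cosBpihalf cosN cos_pihalf subr0 opprK subrK.
Qed.

(** At angle 0 the three weights are 1, 0, 0, and each of them is Lipschitz in the angle with
    constant 2/3. A correction therefore costs no more than a multiple of the angle. *)
Lemma pcoef_lipschitz k n :
  `|pcoef k n 0 - 1| + `|pcoef k n 1| + `|pcoef k n (-1)| <= 2 * `|angle k n|.
Proof.
have H q : `|pcoef k n q - pcoef k 0 q| <= 2 / 3 * `|angle k n|.
  rewrite /pcoef angle0 add0r -mulrBl opprD addrACA subrr add0r -mulrBr.
  rewrite mulrAC normrM ger0_norm ?ler_wpM2l// ?divr_ge0//.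
  by apply: le_trans (cos_lipschitz _ _) _; rewrite addrK.
have := H 0; have := H 1; have := H (-1).
rewrite [pcoef k 0 0]/pcoef [pcoef k 0 1]/pcoef [pcoef k 0 (-1)]/pcoef angle0 !add0r mul0r mul1r mulN1r.
rewrite cosN cos0 cos_third.
have -> : (1 + 2 * (-1 / 2)) / 3 = 0 :> R by field.
have -> : (1 + 2 * 1) / 3 = 1 :> R by field.
rewrite !subr0; lra.
Qed.

(* A list of pairs (c, n) stands for the sum of the c e^(i n theta). The interpolation
   of e^(i n theta) by n and n +- freq k with the weights [pcoef] does not see theta_k;
   [rotate_list] is the correction that this adds. *)
Definition rotate_list k (l : seq (R * int)) : seq (R * int) :=
  flatten [seq [:: (p.1 * (pcoef k p.2 0 - 1), p.2);
                   (p.1 * pcoef k p.2 1, p.2 + freq k);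
                   (p.1 * pcoef k p.2 (-1), p.2 - freq k)] | p <- l].

(* (1 - 4 cos (freq k * theta)) / 3, which is -1 if theta_k = 0 and 1 otherwise. *)
Definition sign_list k : seq (R * int) :=
  [:: (1 / 3, 0); (- 2 / 3, freq k); (- 2 / 3, - freq k)].

Fixpoint flist (g : nat -> R) K : seq (R * int) :=
  if K is k.+1 then
    flist g k ++ (rotate_list k (flist g k) ++ [seq (g k * p.1, p.2) | p <- sign_list k])
  else [::].

Definition finc (g : nat -> R) k :=
  rotate_list k (flist g k) ++ [seq (g k * p.1, p.2) | p <- sign_list k].

Lemma flistS g k : flist g k.+1 = flist g k ++ finc g k. Proof. by []. Qed.

Lemma big_rotate_list k l (F : int -> R) :
  \sum_(p <- rotate_list k l) p.1 * F p.2 =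
  \sum_(p <- l) p.1 * ((pcoef k p.2 0 - 1) * F p.2 +
    pcoef k p.2 1 * F (p.2 + freq k) + pcoef k p.2 (-1) * F (p.2 - freq k)).
Proof.
elim: l => [|p l IH]; first by rewrite !big_nil.
by rewrite /rotate_list/= !big_cons/= -/(rotate_list k l) IH; ring.
Qed.

(* The function of [flist g K] is the sum of the signs weighted by g, hence it is
   constant, equal to psi z, on the event that defines [walk]. *)
Lemma walk_pairing (S : zmodType) (v : nat -> S) (psi : S -> R) (g : nat -> R) K m z :
  (forall x y, psi (x - y) = psi x - psi y) ->
  (forall k, (k < K)%N -> psi (v k) = g k) ->
  \sum_(p <- flist g K) p.1 * walk v (tc (p.2 + m)) K z = psi z * walk v (tc m) K z.
Proof.
move=> psiB; have psi0 : psi 0 = 0 by rewrite -(subrr 0) psiB subrr.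
have psiD x y : psi (x + y) = psi x + psi y.
  by rewrite -{1}(opprK y) psiB -(sub0r y) psiB psi0 sub0r opprK.
elim: K z => [|k IH] z psiv.
  by rewrite big_nil /walk/=; case: eqP => [->|]; rewrite ?psi0 ?mul0r ?mulr0.
have {}IH z' := IH z' (fun i ik => psiv i (ltnW ik)).
rewrite flistS /finc !big_cat.
rewrite (big_rotate_list _ _ (fun n => walk v (tc (n + m)) k.+1 z)).
rewrite big_map !big_cons big_nil/= !walkS addr0.
rewrite addrA -big_split/=.
under eq_bigr => p _.
  rewrite -mulrDr !walkS.
  have walkE n x :
    (walk v (tc (p.2 + freq k + n)) k x = walk v (tc (p.2 + n)) k x) *
    (walk v (tc (p.2 - freq k + n)) k x = walk v (tc (p.2 + n)) k x).
    by split; apply: eq_walk => i ik;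
      rewrite addrAC ?tcD_freq ?tcB_freq.
  rewrite !walkE.
  have tck := pcoef_tc k p.2 m; have p1 := pcoef_sum k p.2.
  rewrite [X in p.1 * X](_ : _ = (walk v (tc (p.2 + m)) k (z + v k) +
    tc m k * walk v (tc (p.2 + m)) k (z - v k)) / 2); last first.
    have p0 : pcoef k p.2 0 = 1 - pcoef k p.2 1 - pcoef k p.2 (-1).
      by rewrite -p1; ring.
    by rewrite -tck p0; field.
  over.
rewrite -mulrDr.
set A := walk v (tc m) k (z + v k); set B := walk v (tc m) k (z - v k).
transitivity ((psi (z + v k) * A + tc m k * (psi (z - v k) * B)) / 2 +
  g k * (- A + tc m k * B) / 2); last first.
  by rewrite psiB psiD psiv//; field.
congr (_ + _).
  rewrite -!IH mulr_sumr -big_split/= mulr_suml.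
  by apply: eq_bigr => p _; ring.
have walkE n : (walk v (tc (freq k + n)) k = walk v (tc n) k) *
    (walk v (tc (- freq k + n)) k = walk v (tc n) k).
  by split; apply/funext => x; apply: eq_walk => i ik;
    rewrite addrC ?tcD_freq ?tcB_freq.
rewrite !walkE !add0r -/A -/B.
(* The three angles differ by thirds of a turn. Hence [sign_list] multiplies the branch theta_k <> 0
   by 1/3 + 2/3 = 1. *)
have tS : tc m k + tc (freq k + m) k + tc (- freq k + m) k = 0.
  by rewrite /tc !angleD angleN angle_freq !cosD cosN sinN cos_third; field.
have -> : tc (freq k + m) k = - tc m k - tc (- freq k + m) k.
  by apply: (addrI (tc m k)); apply: (addIr (tc (- freq k + m) k)); rewrite tS; ring.
by field.
Qed.

End Frequencies.

(** * Absolute summability of the corrected series of signs *)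

Section ListNorms.
Variable R : realType.
Implicit Types (l : seq (R * int)) (g : nat -> R).

Definition lnorm l : R := \sum_(p <- l) `|p.1|.

Lemma lnorm_cat l l' : lnorm (l ++ l') = lnorm l + lnorm l'.
Proof. by rewrite /lnorm big_cat. Qed.

Lemma lnorm_ge0 l : 0 <= lnorm l.
Proof. by apply: sumr_ge0. Qed.

Lemma lnorm_flist g K : lnorm (flist g K) = \sum_(k < K) lnorm (finc g k).
Proof.
elim: K => [|K IH]; first by rewrite /lnorm big_nil big_ord0.
by rewrite flistS lnorm_cat big_ord_recr IH.
Qed.

Definition deg (K : nat) : nat := (\sum_(k < K) 3 ^ (k ^ 2))%N.

Lemma degS K : deg K.+1 = (deg K + 3 ^ (K ^ 2))%N.
Proof. by rewrite /deg big_ord_recr. Qed.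

(** This is what the quadratic exponents are for: from K^2 to (K+1)^2 one gains 3^(2K+1), so that
    the frequencies used before step K make an angle O(3^-K) with theta_K. *)
Lemma deg_le K : (deg K * 3 ^ K <= 3 ^ (K ^ 2).+1)%N.
Proof.
elim: K => [|K IH]; first by rewrite /deg big_ord0.
rewrite degS.
have e : ((K.+1 ^ 2).+1 = (K ^ 2).+1 + K + K.+1)%N by rewrite !expnS !expn0 !muln1; lia.
rewrite e expnD leq_mul2r; apply/orP; right.
rewrite expnD.
have h1 : (deg K <= 3 ^ (K ^ 2).+1)%N.
  by apply: leq_trans IH; rewrite leq_pmulr// expn_gt0.
have K1 : (0 < 3 ^ K)%N by rewrite expn_gt0.
case: K IH e h1 K1 => [|K] IH e h1 K1; first by rewrite /deg big_ord0.
have K3 : (3 <= 3 ^ K.+1)%N by rewrite expnS leq_pmulr// expn_gt0.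
apply: leq_trans (leq_mul (leqnn _) K3).
by move: h1; rewrite expnS; lia.
Qed.

Lemma flist_deg g K p : p \in flist g K -> (`|p.2| <= deg K)%N.
Proof.
elim: K p => // K IH p; rewrite flistS mem_cat => /orP[/IH|].
  by rewrite degS; lia.
have degk : (3 ^ (K ^ 2) = `|freq K|)%N by [].
have absD (a b : int) : (`|(a + b)%R| <= `|a| + `|b|)%N by lia.
have absB (a b : int) : (`|(a - b)%R| <= `|a| + `|b|)%N by lia.
rewrite degS degk mem_cat => /orP[|].
  move=> /flattenP[l /mapP[q /IH qK ->]].
  rewrite !inE => /or3P[] /eqP->/=.
  - by apply: leq_trans qK (leq_addr _ _).
  - by apply: leq_trans (absD _ _) _; rewrite leq_add2r.
  - by apply: leq_trans (absB _ _) _; rewrite leq_add2r.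
move=> /mapP[q]; rewrite !inE => /or3P[] /eqP-> -> /=.
- by [].
- by rewrite leq_addl.
- by rewrite abszN leq_addl.
Qed.

Lemma angle_flist g K p : p \in flist g K -> `|angle R K p.2| <= 8 / 3 ^+ K.
Proof.
move=> /flist_deg pK.
have -> : `|angle R K p.2| = 2 * pi * `|p.2|%N%:R / 3 ^+ (K ^ 2).+1.
  rewrite /angle !normrM normfV (gtr0_norm (pi_gt0 R)) normrX !normr_nat.
  by rewrite -intr_norm -abszE -pmulrn.
rewrite ler_pdivrMr ?exprn_gt0// [8 / _ * _]mulrAC ler_pdivlMr ?exprn_gt0//.
have pi4 : pi <= 4 :> R by have := @pihalf_lt2 R; lra.
apply: (@le_trans _ _ (8 * (deg K * 3 ^ K)%N%:R)).
  rewrite natrM natrX mulrA ler_wpM2r ?exprn_ge0//.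
  apply: ler_pM => //; rewrite ?mulr_ge0 ?pi_ge0//; first by lra.
  by rewrite ler_nat.
by rewrite -natrX ler_wpM2l// ler_nat deg_le.
Qed.

Lemma lnorm_rotate_list K l (D : R) :
  (forall p, p \in l -> `|angle R K p.2| <= D) ->
  lnorm (rotate_list K l) <= 2 * D * lnorm l.
Proof.
elim: l => [|p l IH] lD; first by rewrite /lnorm !big_nil mulr0.
rewrite /lnorm /rotate_list/= !big_cons/= -/(rotate_list K l) [2 * D * _]mulrDr.
rewrite !addrA lerD//; last by apply: IH => q ql; apply: lD; rewrite inE ql orbT.
have pD := lD p (mem_head _ _).
rewrite !(normrM p.1) -!mulrDr mulrC ler_wpM2r//.
by apply: le_trans (pcoef_lipschitz _ _ _) _; rewrite ler_wpM2l.
Qed.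

(** The first term is the cost of the rotation, the angles being at most 8 / 3^K; the coefficients
    of [sign_list] have total mass 5/3, rounded up to 2. *)
Lemma lnorm_finc g K :
  lnorm (finc g K) <= 16 / 3 ^+ K * lnorm (flist g K) + 2 * `|g K|.
Proof.
rewrite /finc lnorm_cat lerD//.
  apply: le_trans (lnorm_rotate_list (@angle_flist g K)) _.
  by rewrite ler_wpM2r ?lnorm_ge0//; lra.
rewrite /lnorm big_map !big_cons big_nil/= addr0 !normrM.
rewrite !(normfV, normrN, normr1, normr_nat).
have := normr_ge0 (g K); lra.
Qed.

Lemma sum_geom3 (K : nat) : \sum_(k < K) 16 / 3 ^+ k <= 24 :> R.
Proof.
suff -> : \sum_(k < K) 16 / 3 ^+ k = 24 - 24 / 3 ^+ K :> R.
  by rewrite gerBl divr_ge0// exprn_ge0.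
elim: K => [|K IH]; first by rewrite big_ord0 expr0; lra.
by rewrite big_ord_recr/= IH exprS; field; rewrite expf_neq0// pnatr_eq0.
Qed.

(** A discrete Gronwall argument: step K multiplies the norm by at most 1 + 16/3^K <= exp(16/3^K)
    and adds 2|g K|, and the exponents sum up to at most 24. *)
Lemma finc_summable g (C : R) : (forall K, \sum_(k < K) `|g k| <= C) ->
  exists A : R, forall K, \sum_(k < K) lnorm (finc g k) <= A.
Proof.
move=> gC.
have bnd K : lnorm (flist g K) <= expR (\sum_(k < K) 16 / 3 ^+ k) * (2 * \sum_(k < K) `|g k|).
  elim: K => [|K IH]; first by rewrite /lnorm big_nil !big_ord0 !mulr0.
  rewrite flistS lnorm_cat !big_ord_recr/= expRD.
  have := lnorm_finc g K.
  set x := 16 / 3 ^+ K; set s := \sum_(_ < K) `|_| in IH *.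
  set E := expR _ in IH *; set N := lnorm _ in IH * => f.
  have x0 : 0 <= x by rewrite divr_ge0// exprn_ge0.
  have ex := expR_ge1Dx x.
  have E1 : 1 <= E.
    by rewrite /E -expR0 ler_expR sumr_ge0// => i _; rewrite divr_ge0// exprn_ge0.
  have s0 : 0 <= s by apply: sumr_ge0.
  have g0 := normr_ge0 (g K).
  have N0 : 0 <= N by exact: lnorm_ge0.
  have eg : 1 <= E * expR x by nra.
  have h1 : N * (1 + x) <= E * expR x * (2 * s).
    rewrite mulrAC; apply: ler_pM => //; lra.
  have h2 : 2 * `|g K| <= E * expR x * (2 * `|g K|) by nra.
  rewrite !mulrDr; lra.
exists (24 * (expR 24 * (2 * C)) + 2 * C) => K.
have C0 : 0 <= C by apply: le_trans (gC 0); rewrite big_ord0.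
have bnd' k : lnorm (flist g k) <= expR 24 * (2 * C).
  apply: le_trans (bnd k) _; apply: ler_pM.
  - exact: expR_ge0.
  - by rewrite mulr_ge0// sumr_ge0.
  - by rewrite ler_expR sum_geom3.
  - by rewrite ler_wpM2l.
apply: (@le_trans _ _ (\sum_(k < K) (16 / 3 ^+ k * (expR 24 * (2 * C)) + 2 * `|g k|))).
  apply: ler_sum => k _; apply: le_trans (lnorm_finc g k) _.
  by rewrite lerD2r ler_wpM2l// divr_ge0// exprn_ge0.
rewrite big_split/= lerD//; last by rewrite -mulr_sumr ler_wpM2l ?gC.
by rewrite -mulr_suml ler_wpM2r ?sum_geom3// !mulr_ge0// expR_ge0.
Qed.

End ListNorms.

Section Levels.

(* Level j has 32(j+1) coordinates: each of them contributes a factor 7/8 at the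
   frequencies that its level damps, and (7/8)^32 <= 1/64. *)
Definition blk (j : nat) : nat := (16 * j * j.+1)%N.

Lemma blkS j : blk j.+1 = (blk j + 32 * j.+1)%N.
Proof. by rewrite /blk; lia. Qed.

Lemma leq_blk i j : (i <= j)%N -> (blk i <= blk j)%N.
Proof. by move=> ij; rewrite /blk; apply: leq_mul; rewrite ?leq_mul. Qed.

Lemma lvl_exists k : exists j, (k < blk j.+1)%N.
Proof. by exists k; rewrite /blk; nia. Qed.

Definition lvl k := ex_minn (lvl_exists k).

Lemma lvlE j k : (blk j <= k < blk j.+1)%N -> lvl k = j.
Proof.
move=> /andP[jk kj]; rewrite /lvl; case: ex_minnP => m km min_m.
apply/eqP; rewrite eqn_leq min_m//= leqNgt; apply/negP => mj.
by have := leq_blk mj; lia.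
Qed.

Lemma big_lvl (T : Type) (idx : T) (op : Monoid.law idx) (F : nat -> T) J :
  \big[op/idx]_(0 <= k < blk J) F (lvl k) =
  \big[op/idx]_(0 <= j < J) iter (32 * j.+1) (op (F j)) idx.
Proof.
elim: J => [|J IH]; first by rewrite !big_nil.
rewrite [RHS]big_nat_recr// -IH (@big_cat_nat _ _ _ (blk J))//; last exact: leq_blk.
congr (op _ _).
rewrite (eq_big_nat _ _ (F2 := fun=> F J)); last by move=> k /lvlE->.
by rewrite big_const_nat blkS addKn.
Qed.

End Levels.

(** * Fourier transform of the law of the signs *)

Section WalkFourier.
Variable R : realType.
Implicit Types (h : int -> R) (w : nat -> int) (t : nat -> R) (z : int).

Lemma walkf_local h h' w t K (M : nat) z :
  (forall x : int, (`|x| < M)%N -> h x = h' x) ->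
  (`|z| + \sum_(k < K) `|w k| < M)%N ->
  walkf h w t K z = walkf h' w t K z.
Proof.
move=> hh'; elim: K z => [|K IH] z /=.
  by rewrite big_ord0 addn0; exact: hh'.
rewrite big_ord_recr/= => zM.
have absD (a b : int) : (`|(a + b)%R| <= `|a| + `|b|)%N by lia.
have absB (a b : int) : (`|(a - b)%R| <= `|a| + `|b|)%N by lia.
by rewrite !IH//; apply: leq_ltn_trans zM;
  rewrite [X in (_ <= _ + X)%N]addnC addnA leq_add2r ?absD ?absB.
Qed.

Lemma walkf_sum (N : nat) (h : nat -> int -> R) w t K z :
  walkf (fun x => \sum_(u < N) h u x) w t K z = \sum_(u < N) walkf (h u) w t K z.
Proof.
elim: K z => //= K IH z.
by rewrite !IH mulr_sumr -big_split/= mulr_suml.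
Qed.

Lemma walkfZ c h w t K z : walkf (fun x => c * h x) w t K z = c * walkf h w t K z.
Proof. by elim: K z => //= K IH z; rewrite !IH; ring. Qed.

(* The amplitude of a wave in z is multiplied at each step, which gives the Fourier
   transform of [walk] in z. *)
Fixpoint amp (th : R) w t K : R * R :=
  if K is k.+1 then
    let c := cos (th * (w k)%:~R) in let s := sin (th * (w k)%:~R) in
    (((1 + t k) * c * (amp th w t k).1 + (1 - t k) * s * (amp th w t k).2) / 2,
     ((1 + t k) * c * (amp th w t k).2 - (1 - t k) * s * (amp th w t k).1) / 2)
  else (1, 0).

Definition wave th w t K z := walkf (fun x => cos (th * x%:~R)) w t K z.

Lemma waveE th w t K z : wave th w t K z =
  (amp th w t K).1 * cos (th * z%:~R) + (amp th w t K).2 * sin (th * z%:~R).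
Proof.
rewrite /wave; elim: K z => [|K IH] z /=; first by rewrite mul1r mul0r addr0.
by rewrite !IH intrD intrB !mulrDr mulrN !cosD !sinD cosN sinN; field.
Qed.

Definition damp (x : R) := (1 + `|cos x|) / 2.

Lemma damp_ge0 x : 0 <= damp x.
Proof. by rewrite divr_ge0// addr_ge0. Qed.

Lemma damp_le1 x : damp x <= 1.
Proof. by rewrite /damp; have := cos_max x; lra. Qed.

(** A step multiplies the squared modulus by (1 + t^2 + 2 t cos 2x)/4, which is at most (1 + |cos
    2x|)/2 whatever t in [-1, 1]. As the bound does not see t, it is uniform over the Fourier
    coefficients m. *)
Lemma amp_norm th w t K : (forall k, (k < K)%N -> `|t k| <= 1) ->
  (amp th w t K).1 ^+ 2 + (amp th w t K).2 ^+ 2 <=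
  \prod_(k < K) damp (2 * (th * (w k)%:~R)).
Proof.
elim: K => [|K IH] tK; first by rewrite big_ord0/= expr0n/= addr0 expr1n.
have {}IH := IH (fun k kK => tK k (ltnW kK)).
rewrite big_ord_recr/=.
set A := (amp _ _ _ _).1 in IH *; set B := (amp _ _ _ _).2 in IH *.
set P := \prod_(_ < _) _ in IH *; set x := th * _.
have := cos2Dsin2 x.
have -> : damp (2 * x) = (1 + `|cos x ^+ 2 - sin x ^+ 2|) / 2.
  by rewrite /damp (_ : 2 * x = x + x) ?cosD -?expr2//; ring.
set c := cos x; set s := sin x => cs1.
have -> : (((1 + t K) * c * A + (1 - t K) * s * B) / 2) ^+ 2 +
  (((1 + t K) * c * B - (1 - t K) * s * A) / 2) ^+ 2 =
  (A ^+ 2 + B ^+ 2) * (((1 + t K ^+ 2) * (c ^+ 2 + s ^+ 2) + 2 * t K * (c ^+ 2 - s ^+ 2)) / 4).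
  by field.
rewrite cs1 mulr1.
have t1 := tK K (ltnSn K).
set e := c ^+ 2 - s ^+ 2.
have te : t K * e <= `|e|.
  by apply: le_trans (ler_norm _) _; rewrite normrM ler_piMl.
have t2 : t K ^+ 2 <= 1 by move: t1; rewrite ler_norml => /andP[? ?]; nra.
apply: ler_pM => //; last by lra.
- by rewrite addr_ge0// sqr_ge0.
- have e1 : e ^+ 2 <= 1.
    have c2 := sqr_ge0 c; have s2 := sqr_ge0 s.
    have : - 1 <= e <= 1 by rewrite /e -cs1; apply/andP; split; lra.
    by case/andP; nra.
  rewrite divr_ge0// (_ : _ + _ = (t K + e) ^+ 2 + (1 - e ^+ 2)); last by ring.
  by rewrite addr_ge0 ?sqr_ge0// subr_ge0.
Qed.

Lemma amp1 th w t K : (forall k, (k < K)%N -> t k = 1) ->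
  amp th w t K = (\prod_(k < K) cos (th * (w k)%:~R), 0).
Proof.
elim: K => [|K IH] tK; first by rewrite big_ord0.
rewrite big_ord_recr/= (IH (fun k kK => tK k (ltnW kK))) tK//=.
by congr (_, _); field.
Qed.

Lemma sum_cos_period (M : nat) z : (`|z| < M)%N ->
  \sum_(u < M) cos (2 * pi * u%:R / M%:R * z%:~R) = M%:R * (z == 0)%:R :> R.
Proof.
move=> zM; have M0 : M%:R != 0 :> R by rewrite pnatr_eq0; lia.
case: eqVneq => [->|z0].
  under eq_bigr do rewrite mulr0 cos0.
  by rewrite sumr_const card_ord mulr1.
rewrite mulr0.
pose n := `|z|%N; have n0 : (0 < n)%N by rewrite absz_gt0.
pose y : R := pi * n%:R / M%:R.
have cz u : cos (2 * pi * u%:R / M%:R * z%:~R) = cos (2 * u%:R * y) :> R.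
  rewrite -[LHS]cos_norm normrM -intr_norm -abszE -pmulrn -/n.
  rewrite ger0_norm ?divr_ge0 ?mulr_ge0 ?pi_ge0//.
  by rewrite /y; congr cos; field.
under eq_bigr do rewrite cz.
have sy : 0 < sin y.
  apply: sin_gt0_pi; rewrite /y divr_gt0 ?mulr_gt0 ?pi_gt0 ?ltr0n//=; last by lia.
  rewrite ltr_pdivrMr ?ltr0n; last by lia.
  by rewrite ltr_pM2l ?pi_gt0// ltr_nat.
apply: (mulIf (lt0r_neq0 sy)); rewrite mul0r.
(* The factor sin y makes the sum telescope; at N = M, the two remaining sines cancel since 2 M y is
   a multiple of 2 pi. *)
have tele N : (\sum_(u < N) cos (2 * u%:R * y)) * sin y =
    (sin ((2 * N%:R - 1) * y) + sin y) / 2.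
  elim: N => [|N IH]; first by rewrite big_ord0 mul0r mulr0 sub0r mulN1r sinN addNr mul0r.
  rewrite big_ord_recr/= mulrDl IH.
  have -> : (2 * N.+1%:R - 1) * y = 2 * N%:R * y + y by rewrite -natr1; ring.
  have -> : (2 * N%:R - 1) * y = 2 * N%:R * y - y by ring.
  by rewrite sinB sinD; field.
rewrite tele.
have -> : (2 * M%:R - 1) * y = - y + (pi *+ 2) *+ n.
  by rewrite /y -mulrnA -(mulr_natr pi) natrM; field.
by rewrite (periodicn (@sinD2pi R)) sinN addNr mul0r.
Qed.

(** Inversion on Z/M is exact, because M exceeds every position reachable from z and nothing wraps
    around. *)
Lemma walk_fourier w t K (M : nat) z :
  (`|z| + \sum_(k < K) `|w k| < M)%N ->
  walk w t K z = M%:R^-1 * \sum_(u < M) wave (2 * pi * u%:R / M%:R) w t K z :> R.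
Proof.
move=> zM; rewrite /walk.
have M0 : M%:R != 0 :> R by rewrite pnatr_eq0; lia.
rewrite (@walkf_local _ (fun x => M%:R^-1 *
    \sum_(u < M) cos (2 * pi * u%:R / M%:R * x%:~R)) w t K M z) //; last first.
  by move=> x xM; rewrite sum_cos_period// mulKf.
by rewrite walkfZ (walkf_sum M (fun u x => cos (2 * pi * u%:R / M%:R * x%:~R))).
Qed.

End WalkFourier.

(** * Smoothness of the law of the sum *)

Section LevelWalk.
Variable R : realType.
Implicit Types (J : nat) (t : nat -> R).

(** The weights 2^-lvl k of the levels up to J, multiplied by 2^J so that the sums of signs are
    integers. *)
Definition wt J k : int := (2 ^ (J - lvl k))%N.

(** A period in u of every |cos ([phase J u] w)| with w an integer. The exponent 6 makes [4 * per J]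
    larger than 128 * 2^J + 2, the bound on the positions in [level_fourier]. *)
Definition per J : nat := (2 ^ (J + 6))%N.

Lemma per_gt0 J : (0 < per J)%N. Proof. by rewrite expn_gt0. Qed.

Lemma sum_wt J : (\sum_(k < blk J.+1) `|wt J k| <= 128 * 2 ^ J)%N.
Proof.
rewrite -(big_mkord xpredT (fun k => `|wt J k|%N)) (big_lvl _ (fun j => 2 ^ (J - j)))%N.
(* The full series of the 32 (j+1) 2^-j has sum 128; [closed] gives its partial sums together with
   the remainder. *)
under eq_bigr do rewrite iter_addn_0.
have closed m : (m <= J)%N ->
    (\sum_(0 <= j < m) 2 ^ (J - j) * (32 * j.+1) + 32 * (2 * m + 4) * 2 ^ (J - m)
     = 128 * 2 ^ J)%N.
  elim: m => [|m IH] mJ; first by rewrite big_nil subn0; lia.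
  rewrite big_nat_recr//= -(IH (ltnW mJ)).
  have -> : (J - m = (J - m.+1).+1)%N by lia.
  by rewrite expnS; lia.
by rewrite big_nat_recr//= -(closed J)// subnn; lia.
Qed.

Lemma sum_lvl K : \sum_(k < K) (2 ^- lvl k) <= 128 :> R.
Proof.
apply: (@le_trans _ _ (\sum_(0 <= k < blk K) (2 ^- lvl k))).
  have KK : (K <= blk K)%N by rewrite /blk; nia.
  rewrite (@big_cat_nat _ _ _ K)//= big_mkord lerDl sumr_ge0// => i _.
rewrite (big_lvl _ (fun j => 2 ^- j)).
have -> : \sum_(0 <= j < K) iter (32 * j.+1) (+%R (2 ^- j)) 0 =
    128 - 32 * (2 * K%:R + 4) / 2 ^+ K :> R.
  elim: K => [|K IH]; first by rewrite big_nil expr0; field.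
  rewrite big_nat_recr// iter_addr_0 -(mulr_natr (2 ^- K)) natrM [LHS]/= IH exprS -!natr1.
  by field; rewrite expf_neq0// pnatr_eq0.
by rewrite gerBl divr_ge0 ?exprn_ge0 ?mulr_ge0 ?addr_ge0 ?mulr_ge0.
Qed.

Lemma norm_cosDnpi (x : R) n : `|cos (x + n%:R * pi)| = `|cos x|.
Proof.
elim: n => [|n IH]; first by rewrite mul0r addr0.
by rewrite -natr1 mulrDl mul1r addrA cosDpi normrN.
Qed.

Lemma norm_sinDnpi (x : R) n : `|sin (x + n%:R * pi)| = `|sin x|.
Proof.
elim: n => [|n IH]; first by rewrite mul0r addr0.
by rewrite -natr1 mulrDl mul1r addrA sinDpi normrN.
Qed.

Definition phase J (u : nat) : R := pi * u%:R / (per J)%:R.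

Definition damping J u : R := \prod_(k < blk J.+1) damp (phase J u * (wt J k)%:~R).

Lemma per_neq0 J : (per J)%:R != 0 :> R.
Proof. by rewrite pnatr_eq0 -lt0n per_gt0. Qed.

Lemma dampingDper J a u : damping J (a * per J + u) = damping J u.
Proof.
apply: eq_bigr => k _; rewrite /damp.
have -> : phase J (a * per J + u) * (wt J k)%:~R =
   phase J u * (wt J k)%:~R + (a * 2 ^ (J - lvl k))%:R * pi.
  rewrite /phase /wt -!pmulrn natrD !natrM; field; exact: per_neq0.
by rewrite norm_cosDnpi.
Qed.

Lemma dampingBper J u : (u <= per J)%N -> damping J (per J - u) = damping J u.
Proof.
move=> uJ; apply: eq_bigr => k _; rewrite /damp.
rewrite -(cosN (phase J (per J - u) * _)).
rewrite -(norm_cosDnpi (- _) (2 ^ (J - lvl k))).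
congr ((1 + `|cos _|) / 2); rewrite /phase /wt -!pmulrn natrB//; field; exact: per_neq0.
Qed.

Lemma damping_le1 J u : damping J u <= 1.
Proof. by apply: prodr_ile1 => k _; rewrite damp_ge0 damp_le1. Qed.

Lemma dampingE J u :
  damping J u = \prod_(j < J.+1) damp (phase J u * 2 ^+ (J - j)) ^+ (32 * j.+1).
Proof.
rewrite /damping -(big_mkord xpredT (fun k => damp (phase J u * (wt J k)%:~R))).
rewrite (big_lvl _ (fun j => damp (phase J u * (2 ^ (J - j))%N%:Z%:~R))) big_mkord.
by apply: eq_bigr => j _; rewrite -pmulrn natrX iter_mulr_1.
Qed.

Lemma damp_mid (x : R) : pi / 4 <= x <= pi / 2 -> damp x <= 7 / 8.
Proof.
move=> /andP[x1 x2]; have pi0 := @pi_gt0 R.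
have c0 : 0 <= cos x by apply: cos_ge0_pihalf; apply/andP; split; lra.
have cx : cos x <= cos (pi / 4).
  case: (eqVneq x (pi / 4)) => [->//|xn].
  rewrite ltW// ltr_cos ?in_itv/=; first by rewrite lt_neqAle eq_sym xn.
    by apply/andP; split; lra.
  by apply/andP; split; lra.
have c4 : cos (pi / 4) ^+ 2 = 1 / 2 :> R.
  have := cos_mulr2n (pi / 4 : R).
  have -> : (pi / 4) *+ 2 = pi / 2 :> R by rewrite mulr2n; field.
  by rewrite cos_pihalf mulr2n => h; lra.
rewrite /damp ger0_norm//.
suff : cos (pi / 4) <= 3 / 4 :> R by lra.
by rewrite leNgt; apply/negP => h; nra.
Qed.

Lemma damp_pow (j : nat) : (7 / 8) ^+ (32 * j.+1) <= (8 ^- j.+1) ^+ 2 :> R.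
Proof.
rewrite exprM -exprVn [leRHS]exprAC lerXn2r ?nnegrE ?exprn_ge0 ?divr_ge0 ?invr_ge0//.
have sqb (y c : R) : 0 <= y -> y <= c -> y ^+ 2 <= c ^+ 2.
  by move=> y0 yc; rewrite lerXn2r ?nnegrE// (le_trans y0).
have p0 n : 0 <= (7 / 8) ^+ n :> R by rewrite exprn_ge0// divr_ge0.
have x4 : (7 / 8) ^+ 4 <= 6 / 10 :> R by lra.
have x8 : (7 / 8) ^+ 8 <= 35 / 100 :> R by lra.
have x16 : (7 / 8) ^+ 16 <= 1225 / 10000 :> R.
  by rewrite (exprM _ 8 2); apply: le_trans (sqb _ _ (p0 _) x8) _; lra.
rewrite (exprM _ 16 2); apply: le_trans (sqb _ _ (p0 _) x16) _; lra.
Qed.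

(** Some doubling 2^i v falls between 2^(J+4) and 2^(J+5), that is, the phase falls in [pi/4, pi/2],
    where level j = J - i damps it by 8^-(2(j+1)); and v <= 16 * 2^(j+1). The amplitudes thus decay
    like v^-3: one power is spent on the derivative, and a summable v^-2 is left. *)
Lemma damping_le J v : (0 < v <= 2 ^ (J + 5))%N ->
  damping J v <= ((16 / v%:R) ^+ 3) ^+ 2.
Proof.
move=> /andP[v0 vJ].
have v0' : 0 < v%:R :> R by rewrite ltr0n.
set q := (2 ^ (J + 5) %/ v)%N.
have q0 : (0 < q)%N by rewrite divn_gt0.
have /andP[iq qi] := trunc_log_bounds (isT : (1 < 2)%N) q0.
set i := trunc_log 2 q in iq qi.
have lo : (v * 2 ^ i <= 2 ^ (J + 5))%N.
  by apply: leq_trans (leq_trunc_div (2 ^ (J + 5)) v); rewrite mulnC leq_mul2r iq orbT.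
have hi : (2 ^ (J + 5) <= v * 2 ^ i.+1)%N.
  rewrite ltnW//; apply: leq_trans (ltn_ceil (2 ^ (J + 5)) v0) _.
  by rewrite mulnC leq_mul2l qi orbT.
(* When no level is left for this doubling, v is at most 16 and the claimed bound is at least 1. *)
case: (leqP i J) => iJ; last first.
  have v16 : (v <= 16)%N.
    rewrite -(leq_pmul2r (expn_gt0 2 J.+1)).
    apply: leq_trans (_ : v * 2 ^ i <= _)%N; first by rewrite leq_mul2l leq_exp2l// iJ orbT.
    by rewrite (leq_trans lo)// -[16%N]/(2 ^ 4)%N -expnD leq_exp2l//; lia.
  apply: le_trans (damping_le1 _ _) _.
  have h : 1 <= 16 / v%:R :> R by rewrite ler_pdivlMr// mul1r ler_nat.
  by rewrite !exprn_ege1.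
set j := (J - i)%N.
have jJ : (j < J.+1)%N by rewrite ltnS leq_subr.
rewrite dampingE (bigD1 (Ordinal jJ))//=.
apply: (@le_trans _ _ (damp (phase J v * 2 ^+ (J - j)) ^+ (32 * j.+1))).
  rewrite ler_piMr ?exprn_ge0 ?damp_ge0//; apply: prodr_ile1 => k _.
  by rewrite exprn_ge0 ?damp_ge0//= exprn_ile1 ?damp_ge0 ?damp_le1.
have pi0 := @pi_gt0 R.
have d78 : damp (phase J v * 2 ^+ (J - j)) <= 7 / 8.
  apply: damp_mid; rewrite subKn//.
  have -> : phase J v * 2 ^+ i = (pi / 2) * ((v * 2 ^ i)%:R / (2 ^ (J + 5))%:R).
    have h : (2 ^ (J + 5))%:R != 0 :> R by rewrite pnatr_eq0 -lt0n expn_gt0.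
    rewrite /phase /per natrM -natrX.
    rewrite (_ : (J + 6 = (J + 5).+1)%N); last by lia.
    by rewrite expnS natrM; field.
  have h : 0 < (2 ^ (J + 5))%:R :> R by rewrite ltr0n expn_gt0.
  have pi20 : 0 <= pi / 2 :> R by rewrite divr_ge0// ltW.
  apply/andP; split; last first.
    by rewrite ler_piMr// ler_pdivrMr// mul1r ler_nat.
  rewrite (_ : pi / 4 = pi / 2 * (1 / 2)); last by field.
  rewrite ler_wpM2l// ler_pdivlMr//.
  have : (2 ^ (J + 5))%:R <= (2 * (v * 2 ^ i))%:R :> R.
    by rewrite ler_nat; move: hi; rewrite expnS; lia.
  by rewrite natrM; lra.
apply: le_trans (_ : (7 / 8) ^+ (32 * j.+1) <= _).
  by rewrite lerXn2r ?nnegrE ?damp_ge0// divr_ge0.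
apply: le_trans (damp_pow j) _.
apply: lerXn2r; rewrite ?nnegrE ?invr_ge0 ?exprn_ge0 ?divr_ge0//.
have vj : (v <= 2 ^ (j + 5))%N.
  rewrite -(leq_pmul2r (expn_gt0 2 i)) (leq_trans lo)// -expnD leq_exp2l//.
  by rewrite /j; lia.
rewrite -(exprVn 8).
have -> : 8^-1 = (2^-1) ^+ 3 :> R by rewrite exprVn; congr _^-1; ring.
rewrite -exprM mulnC exprM lerXn2r ?nnegrE ?exprn_ge0 ?invr_ge0 ?divr_ge0//.
rewrite exprVn ler_pdivlMr// mulrC ler_pdivrMr ?exprn_gt0//.
apply: (@le_trans _ _ (2 ^ (j + 5))%:R); first by rewrite ler_nat.
rewrite (_ : (j + 5 = 4 + j.+1)%N); last by lia.
rewrite expnD natrM (natrX R 2 j.+1) ler_wpM2r ?exprn_ge0//.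
Qed.

End LevelWalk.

(** * Size of the density and of its difference quotient at the origin *)

Section WalkBounds.
Variable R : realType.
Implicit Types (J : nat) (t : nat -> R).

Lemma sum_modn (q n : nat) (b : nat -> R) : (0 < q)%N ->
  \sum_(u < n * q) b (u %% q)%N = n%:R * \sum_(r < q) b r.
Proof.
move=> q0; elim: n => [|n IH]; first by rewrite mul0n big_ord0 mul0r.
rewrite -natr1 mulrDl mul1r -IH -(big_mkord xpredT (fun u => b (u %% q)%N)).
rewrite (@big_cat_nat _ _ _ (n * q))//=; last by rewrite mulSn leq_addl.
rewrite big_mkord; congr (_ + _).
rewrite -{1}(add0n (n * q)%N) big_addn mulSn addnK big_mkord.
by apply: eq_bigr => i _; rewrite addnC modnMDl modn_small.
Qed.

Lemma sum_invsq (q : nat) : \sum_(r < q) (r%:R ^- 2) <= 2 :> R.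
Proof.
case: q => [|q]; first by rewrite big_ord0.
(* Comparison with a telescoping series. The term r = 0 vanishes since the inverse of 0 is 0, whence
   the separate value at q = 0. *)
suff : \sum_(r < q.+1) (r%:R ^- 2) <= 2 - (if q is 0%N then 2 else q%:R^-1) :> R.
  by move/le_trans; apply; rewrite gerBl; case: q.
elim: q => [|q IH]; first by rewrite big_ord_recr big_ord0/= expr0n invr0 addr0 subrr.
rewrite big_ord_recr/=; apply: le_trans (lerD IH (lexx _)) _.
case: q {IH} => [|q]; first by rewrite !invr1 expr1n invr1; lra.
rewrite -addrA lerD2l.
have q0 : 0 < q.+1%:R :> R by rewrite ltr0n.
rewrite -(natr1 q.+1); set x : R := q.+1%:R in q0 *.
rewrite -subr_ge0 (_ : _ - _ = (x * (x + 1) ^+ 2)^-1).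
  by rewrite invr_ge0 mulr_ge0 ?sqr_ge0// ltW.
field; rewrite !lt0r_neq0//; lra.
Qed.

Lemma sum_invsq_rev (q : nat) : \sum_(r < q) ((q - r)%:R ^- 2) <= 4 :> R.
Proof.
rewrite (reindex_inj rev_ord_inj)/=.
apply: (@le_trans _ _ (\sum_(r < q.+1) (r%:R ^- 2))); last first.
  by apply: le_trans (sum_invsq _) _; lra.
rewrite big_ord_recl/=; apply: ler_wpDl; first by rewrite invr_ge0 exprn_ge0.
by apply: ler_sum => i _; rewrite /bump/= subKn// ltn_ord.
Qed.

(** For 0 < r < q it dominates v^-2, where v is the distance from r to the nearest multiple of q. *)
Definition invsq2 (q r : nat) : R := r%:R ^- 2 + (q - r)%:R ^- 2.

Lemma invsq2_ge0 q r : 0 <= invsq2 q r.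
Proof. by rewrite addr_ge0// invr_ge0 exprn_ge0. Qed.

Lemma sum_invsq2 q : \sum_(r < q) invsq2 q r <= 6.
Proof.
by rewrite big_split/=; have := sum_invsq q; have := sum_invsq_rev q; lra.
Qed.

Lemma damping_modn J u : damping R J (u %% per J) = damping R J u.
Proof. by rewrite [in RHS](divn_eq u (per J)) dampingDper. Qed.

Lemma damping_invsq2 J r v : (0 < r < per J)%N -> v = minn r (per J - r) ->
  [/\ (0 < v)%N, damping R J r <= ((16 / v%:R) ^+ 3) ^+ 2 & v%:R ^- 2 <= invsq2 (per J) r].
Proof.
move=> /andP[r0 rJ] ->.
have half : (2 ^ (J + 5) + 2 ^ (J + 5) = per J)%N.
  rewrite /per (_ : (J + 6 = (J + 5).+1)%N); last by lia.
  by rewrite expnS mul2n addnn.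
case: (leqP r (per J - r)) => rr; split => //.
- by apply: damping_le; lia.
- by rewrite lerDl invr_ge0 exprn_ge0.
- by rewrite subn_gt0.
- by rewrite -dampingBper; [apply: damping_le|]; lia.
- by rewrite lerDr invr_ge0 exprn_ge0.
Qed.

Lemma phase_sin J u : `|sin (phase R J u)| = `|sin (phase R J (u %% per J))|.
Proof.
rewrite {1}(divn_eq u (per J)).
have -> : phase R J (u %/ per J * per J + u %% per J) =
  phase R J (u %% per J) + (u %/ per J)%:R * pi.
  by rewrite /phase natrD natrM; field; exact: per_neq0.
by rewrite norm_sinDnpi.
Qed.

Lemma sin_phase_le J r v : (r < per J)%N -> v = minn r (per J - r) ->
  `|sin (phase R J r)| <= 4 * v%:R / (per J)%:R.
Proof.
move=> rJ ->.
have p0 : 0 < (per J)%:R :> R by rewrite ltr0n per_gt0.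
have pi4 : pi <= 4 :> R by have := @pihalf_lt2 R; lra.
have H (s : nat) : `|sin (phase R J s)| <= 4 * s%:R / (per J)%:R.
  apply: le_trans (norm_sin_le _) _.
  rewrite /phase ger0_norm; last by rewrite divr_ge0 ?mulr_ge0 ?pi_ge0.
  by rewrite ler_wpM2r ?invr_ge0// ler_wpM2r.
case: leqP => _; first exact: H.
apply: le_trans (H _); rewrite -(norm_sinDnpi _ 1) -(normrN (sin _)) -sinN.
rewrite (_ : - _ = phase R J (per J - r) - 2%:R * pi); last first.
  by rewrite /phase natrB ?(ltnW rJ)//; field; exact: per_neq0.
by rewrite -[leLHS](norm_sinDnpi _ 2) subrK.
Qed.

(** The frequencies of the inversion on Z/(4 [per J]); [phase] is twice this, the squared amplitudes
    being governed by double angles. *)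
Definition th J (u : nat) : R := 2 * pi * u%:R / (4 * per J)%:R.

Lemma th_phase J u : 2 * th J u = phase R J u.
Proof. by rewrite /th /phase natrM; field; exact: per_neq0. Qed.

Lemma level_fourier J t z : (`|z| <= 2)%N ->
  walk (wt J) t (blk J.+1) z =
  (4 * per J)%:R^-1 * \sum_(u < 4 * per J) wave (th J u) (wt J) t (blk J.+1) z :> R.
Proof.
move=> z2; apply: walk_fourier.
have := sum_wt J; rewrite /per expnD.
have : (0 < 2 ^ J)%N by rewrite expn_gt0.
lia.
Qed.

Section Bounds.
Variables (J : nat) (t : nat -> R).
Hypothesis t1 : forall k, `|t k| <= 1.

Lemma amp_damping u :
  (amp (th J u) (wt J) t (blk J.+1)).1 ^+ 2 +
  (amp (th J u) (wt J) t (blk J.+1)).2 ^+ 2 <= damping R J u.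
Proof.
apply: le_trans (amp_norm _ _ _) _ => //.
rewrite le_eqVlt; apply/orP; left; apply/eqP; apply: eq_bigr => k _.
by rewrite mulrA th_phase.
Qed.

Lemma normr_le_sqr (x y : R) : 0 <= y -> x ^+ 2 <= y ^+ 2 -> `|x| <= y.
Proof. by move=> y0; rewrite -[x ^+ 2]real_normK ?num_real// ler_pXn2r// nnegrE. Qed.

(* Up to scaling, [d0] is the density at 0 and [d1] its derivative. *)
Definition d0 := walk (wt J) t (blk J.+1) 2 + walk (wt J) t (blk J.+1) (- 2).

Definition d1 := walk (wt J) t (blk J.+1) 2 - walk (wt J) t (blk J.+1) (- 2).

Lemma wave_le u z (K : R) : 0 <= K -> damping R J u <= K ^+ 2 ->
  `|wave (th J u) (wt J) t (blk J.+1) z| <= K.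
Proof.
move=> K0 dK; apply: normr_le_sqr => //; apply: le_trans dK.
apply: le_trans (amp_damping u); rewrite waveE.
have := cos2Dsin2 (th J u * z%:~R).
set A := (amp _ _ _ _).1; set B := (amp _ _ _ _).2.
set c := cos _; set s := sin _ => cs.
have -> : A ^+ 2 + B ^+ 2 = (A * c + B * s) ^+ 2 + (A * s - B * c) ^+ 2.
  by rewrite -[LHS]mulr1 -cs; ring.
by rewrite lerDl sqr_ge0.
Qed.

(** Each of the four periods contributes at most 1 from its multiple of [per J], and the sum of 16^3
    v^-2 from the other frequencies. *)
Lemma level_le z : (`|z| <= 2)%N ->
  `|walk (wt J) t (blk J.+1) z| <= (1 + 6 * 16 ^+ 3) / (per J)%:R :> R.
Proof.
move=> z2; rewrite level_fourier// normrM ger0_norm ?invr_ge0//.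
have p0 : 0 < (4 * per J)%:R :> R by rewrite ltr0n muln_gt0 per_gt0.
have c30 : 0 <= 16 ^+ 3 :> R by rewrite exprn_ge0.
rewrite ler_pdivrMl//; set c3 : R := 16 ^+ 3 in c30 *.
pose b (r : nat) : R := (r == 0%N)%:R + c3 * invsq2 (per J) r.
apply: le_trans (ler_norm_sum _ _ _) _.
apply: (@le_trans _ _ (\sum_(u < 4 * per J) b (u %% per J)%N)).
  apply: ler_sum => u _; rewrite /b.
  case: (posnP (u %% per J)) => r0.
    apply: le_trans (wave_le _ ler01 _) _; first by rewrite expr1n damping_le1.
    by rewrite r0 lerDl mulr_ge0// invsq2_ge0.
  have rp : (0 < u %% per J < per J)%N by rewrite r0 ltn_mod per_gt0.
  have [v0 dv vi] := damping_invsq2 rp erefl.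
  rewrite add0r.
  have v0' : 1 <= (minn (u %% per J) (per J - u %% per J))%:R :> R by rewrite ler1n.
  set v : R := _%:R in v0' dv vi.
  apply: le_trans (wave_le (K := (16 / v) ^+ 3) _ _ _) _.
  - by rewrite exprn_ge0// divr_ge0//; lra.
  - by rewrite -damping_modn.
  rewrite expr_div_n -/c3; apply: ler_wpM2l => //; apply: le_trans vi.
  rewrite lef_pV2 ?posrE ?exprn_gt0 ?(lt_le_trans ltr01)//.
  by rewrite [leRHS]exprS ler_peMl// exprn_ge0//; lra.
rewrite sum_modn ?per_gt0// big_split/= -mulr_sumr.
have -> : \sum_(i < per J) (i == 0%N :> nat)%:R = 1 :> R.
  rewrite (bigD1 (Ordinal (per_gt0 J)))//= big1 ?addr0// => i.
  by rewrite -val_eqE/= => /negPf->.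
have := sum_invsq2 (per J); set s := \sum_(_ < _) _ => s6.
rewrite [leRHS](_ : _ = 4 * (1 + 6 * c3)); last first.
  by rewrite natrM; field; exact: per_neq0.
by rewrite ler_wpM2l// lerD2l mulrC ler_wpM2r.
Qed.

Lemma d0_le : `|d0| <= 2 * ((1 + 6 * 16 ^+ 3) / (per J)%:R).
Proof.
apply: le_trans (ler_normD _ _) _.
by rewrite mulr_natl mulr2n lerD// level_le.
Qed.

(** The difference brings in a factor sin(phase), which is 0 at the multiples of [per J] and at most
    4 v / [per J] elsewhere: one factor 1 / [per J] is gained over [d0_le] for one power of v. *)
Lemma d1_le : `|d1| <= 48 * 16 ^+ 3 / (per J)%:R ^+ 2.
Proof.
rewrite /d1 !level_fourier// -mulrBr -sumrB normrM ger0_norm ?invr_ge0//.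
have p0 : 0 < (4 * per J)%:R :> R by rewrite ltr0n muln_gt0 per_gt0.
have p1 : 0 < (per J)%:R :> R by rewrite ltr0n per_gt0.
have c30 : 0 <= 16 ^+ 3 :> R by rewrite exprn_ge0.
rewrite ler_pdivrMl//; set c3 : R := 16 ^+ 3 in c30 *.
pose b (r : nat) : R := 8 * c3 / (per J)%:R * invsq2 (per J) r.
have b0 : 0 <= 8 * c3 / (per J)%:R by rewrite divr_ge0// mulr_ge0.
apply: le_trans (ler_norm_sum _ _ _) _.
apply: (@le_trans _ _ (\sum_(u < 4 * per J) b (u %% per J)%N)).
  apply: ler_sum => u _; rewrite /b.
  have -> : wave (th J u) (wt J) t (blk J.+1) 2 - wave (th J u) (wt J) t (blk J.+1) (- 2)
    = 2 * ((amp (th J u) (wt J) t (blk J.+1)).2 * sin (phase R J u)).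
    rewrite !waveE mulrNz mulrN cosN sinN -th_phase (mulrC (th J u)).
    by rewrite -[2%:~R]/(2 : R); ring.
  rewrite normrM normr_nat normrM phase_sin.
  case: (posnP (u %% per J)) => r0.
    rewrite r0 /phase mulr0 mul0r sin0 normr0 !mulr0.
    by rewrite mulr_ge0 ?invsq2_ge0.
  have rp : (0 < u %% per J < per J)%N by rewrite r0 ltn_mod per_gt0.
  have [v0 dv vi] := damping_invsq2 rp erefl.
  have rp' : (u %% per J < per J)%N by case/andP: rp.
  have := sin_phase_le rp' erefl.
  have v0' : 1 <= (minn (u %% per J) (per J - u %% per J))%:R :> R by rewrite ler1n.
  set v : R := _%:R in v0' dv vi * => sv.
  have v00 : v != 0 by rewrite lt0r_neq0//; lra.
  have ampv : `|(amp (th J u) (wt J) t (blk J.+1)).2| <= (16 / v) ^+ 3.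
    apply: normr_le_sqr; first by rewrite exprn_ge0// divr_ge0//; lra.
    apply: le_trans dv; rewrite damping_modn; apply: le_trans (amp_damping u).
    by rewrite lerDr sqr_ge0.
  apply: (@le_trans _ _ (2 * ((16 / v) ^+ 3 * (4 * v / (per J)%:R)))).
    by rewrite ler_wpM2l//; apply: ler_pM.
  rewrite expr_div_n -/c3 [leLHS](_ : _ = 8 * c3 / (per J)%:R * v ^- 2).
    by rewrite ler_wpM2l.
  by field; rewrite v00 per_neq0.
rewrite sum_modn ?per_gt0// -mulr_sumr.
have := sum_invsq2 (per J); set s := \sum_(_ < _) _ => s6.
rewrite [leRHS](_ : _ = 4 * (8 * c3 / (per J)%:R * 6)); last first.
  by rewrite natrM; field; exact: per_neq0.
by rewrite ler_wpM2l// ler_wpM2l.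
Qed.

End Bounds.

(** For t = 1, [walk] is a genuine probability law. All terms of the inversion formula at 0 are
    nonnegative, because every level has an even number of equal cosines, and frequency 0 alone
    contributes 1. *)
Lemma d0_ge J t : (forall k, t k = 1) -> (4 * per J)%:R^-1 <= d0 J t.
Proof.
move=> t1.
have nonneg K z : 0 <= walk (wt J) t K z :> R.
  elim: K z => [|K IH] z; first by rewrite /walk/= ler0n.
  by rewrite walkS t1 mul1r divr_ge0// addr_ge0.
(* The last sign has weight 1, so the mass at 0 is half of the masses at 1 and -1 one step earlier,
   and these also feed 2 and -2. *)
apply: (@le_trans _ _ (walk (wt J) t (blk J.+1) 0)); last first.
  rewrite /d0; have -> : blk J.+1 = (blk J + 32 * J.+1).-1.+1 by rewrite blkS; lia.
  set K := (_).-1; rewrite !walkS t1.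
  have -> : wt J K = 1 by rewrite /wt (@lvlE J) ?subnn// blkS /K; lia.
  have := nonneg K 3; have := nonneg K (-3).
  rewrite !mul1r !add0r -[2 + 1]/(3 : int) -[2 - 1]/(1 : int).
  rewrite -[-2 + 1]/(-1 : int) -[- 2 - 1]/(-3 : int); lra.
rewrite level_fourier//.
rewrite ler_peMr ?invr_ge0//.
have waveE1 u : wave (th J u) (wt J) t (blk J.+1) 0 =
    \prod_(k < blk J.+1) cos (th J u * (wt J k)%:~R).
  by rewrite waveE mulr0 cos0 sin0 mulr0 mulr1 addr0 amp1.
have wave0 u : 0 <= wave (th J u) (wt J) t (blk J.+1) 0.
  rewrite waveE1 -(big_mkord xpredT (fun k => cos (th J u * (wt J k)%:~R))).
  rewrite (big_lvl _ (fun j => cos (th J u * (2 ^ (J - j))%N%:Z%:~R))).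
  apply: prodr_ge0 => j _; rewrite iter_mulr_1.
  by rewrite exprn_even_ge0// oddM.
have p0 : (0 < 4 * per J)%N by rewrite muln_gt0 per_gt0.
rewrite (bigD1 (Ordinal p0))//= waveE1 big1; first by rewrite lerDl sumr_ge0.
by move=> k _; rewrite /th mulr0 !mul0r cos0.
Qed.

End WalkBounds.

(** * The functional in the plane and its products with the two series *)

Section Functional.
Variable R : realType.
Implicit Types (J : nat) (t : nat -> R) (m : int).

(** Even coordinates move the first component and odd ones the second, so that f1 and f2 depend on
    disjoint families of signs and the planar law is a product. *)
Definition wt2 J k : int * int :=
  if odd k then (0, wt J k./2) else (wt J k./2, 0).

Lemma walk_wt2 J t K (z : int * int) :
  walk (wt2 J) t K.*2 z =
  walk (wt J) (fun i => t i.*2) K z.1 * walk (wt J) (fun i => t i.*2.+1) K z.2.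
Proof.
elim: K z => [|K IH] [x y].
  by rewrite /walk/= -natrM mulnb -xpair_eqE.
have addE (a b c d : int) : ((a, b) + (c, d) = (a + c, b + d)) *
  ((a, b) - (c, d) = (a - c, b - d)) by split.
rewrite doubleS !walkS /wt2 !odd_double /= odd_double uphalf_double doubleK !addE !IH /=.
by rewrite !addr0; field.
Qed.

Lemma addrr_mul2 (x : R) : x + x = 2 * x. Proof. by ring. Qed.

Definition gam1 k : R := if odd k then 0 else 2 ^- lvl k./2.

Definition gam2 k : R := if odd k then 2 ^- lvl k./2 else 0.

Lemma lvl_le j k : (k < blk j.+1)%N -> (lvl k <= j)%N.
Proof. by move=> kj; rewrite /lvl; case: ex_minnP => i _; exact. Qed.

Lemma wt_lvl J k : (k < blk J.+1)%N -> 2 ^- J * (wt J k)%:~R = 2 ^- lvl k :> R.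
Proof.
move=> /lvl_le kJ; rewrite /wt -pmulrn natrX -{1}(subnK kJ) exprD.
by field; rewrite !expf_neq0// pnatr_eq0.
Qed.

Lemma sum_gam1 K : \sum_(k < K) `|gam1 k| <= 128.
Proof.
apply: le_trans (sum_lvl R K).
apply: (@le_trans _ _ (\sum_(k < K.*2) `|gam1 k|)).
  rewrite -!(big_mkord xpredT (fun k => `|gam1 k|)).
  by rewrite (@big_cat_nat _ _ _ K _ K.*2)//= -?addnn ?leq_addl// lerDl sumr_ge0.
elim: K => [|K IH]; first by rewrite !big_ord0.
rewrite doubleS !big_ord_recr/= -addrA lerD//.
rewrite /gam1/= !odd_double/= doubleK normr0 addr0 ger0_norm//.
Qed.

Lemma sum_gam2 K : \sum_(k < K) `|gam2 k| <= 128.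
Proof.
apply: le_trans (sum_lvl R K).
apply: (@le_trans _ _ (\sum_(k < K.*2) `|gam2 k|)).
  rewrite -!(big_mkord xpredT (fun k => `|gam2 k|)).
  by rewrite (@big_cat_nat _ _ _ K _ K.*2)//= -?addnn ?leq_addl// lerDl sumr_ge0.
elim: K => [|K IH]; first by rewrite !big_ord0.
rewrite doubleS !big_ord_recr/= -addrA lerD//.
rewrite /gam2/= !odd_double/= uphalf_double normr0 add0r ger0_norm//.
Qed.

Definition ncoord J := (blk J.+1).*2.

Definition F1 J := flist gam1 (ncoord J).
Definition F2 J := flist gam2 (ncoord J).

Lemma pairing1 J m z :
  \sum_(p <- F1 J) p.1 * walk (wt2 J) (tc R (p.2 + m)) (ncoord J) z =
  2 ^- J * z.1%:~R * walk (wt2 J) (tc R m) (ncoord J) z.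
Proof.
apply: (walk_pairing (psi := fun z : int * int => 2 ^- J * z.1%:~R)).
  by move=> x y; rewrite /= intrB mulrBr.
move=> k kJ; rewrite /wt2 /gam1; case: ifP => _ /=; first by rewrite mulr0.
by rewrite wt_lvl// ltn_half_double.
Qed.

Lemma pairing2 J m z :
  \sum_(p <- F2 J) p.1 * walk (wt2 J) (tc R (p.2 + m)) (ncoord J) z =
  2 ^- J * z.2%:~R * walk (wt2 J) (tc R m) (ncoord J) z.
Proof.
apply: (walk_pairing (psi := fun z : int * int => 2 ^- J * z.2%:~R)).
  by move=> x y; rewrite /= intrB mulrBr.
move=> k kJ; rewrite /wt2 /gam2; case: ifP => _ /=; last by rewrite mulr0.
by rewrite wt_lvl// ltn_half_double.
Qed.

Definition te m k : R := tc R m k.*2.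
Definition to m k : R := tc R m k.*2.+1.

Definition A0 J m : R := d0 J (te m).
Definition A1 J m : R := d1 J (te m).
Definition B0 J m : R := d0 J (to m).
Definition B1 J m : R := d1 J (to m).

(** With e and f equal to 1 or -1, each component is a sum or a difference: one expansion over the
    four points serves the four products that follow. *)
Lemma pairing_AB J (l : seq (R * int)) m (c : int * int -> R) :
  (forall z, \sum_(p <- l) p.1 * walk (wt2 J) (tc R (p.2 + m)) (ncoord J) z =
     c z * walk (wt2 J) (tc R m) (ncoord J) z) ->
  forall e f : R,
  \sum_(p <- l) p.1 *
    ((walk (wt J) (te (p.2 + m)) (blk J.+1) 2 + e * walk (wt J) (te (p.2 + m)) (blk J.+1) (-2)) *
     (walk (wt J) (to (p.2 + m)) (blk J.+1) 2 + f * walk (wt J) (to (p.2 + m)) (blk J.+1) (-2))) =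
  c (2, 2) * (walk (wt J) (te m) (blk J.+1) 2 * walk (wt J) (to m) (blk J.+1) 2) +
  f * (c (2, -2) * (walk (wt J) (te m) (blk J.+1) 2 * walk (wt J) (to m) (blk J.+1) (-2))) +
  e * (c (-2, 2) * (walk (wt J) (te m) (blk J.+1) (-2) * walk (wt J) (to m) (blk J.+1) 2)) +
  e * f * (c (-2, -2) * (walk (wt J) (te m) (blk J.+1) (-2) * walk (wt J) (to m) (blk J.+1) (-2))).
Proof.
move=> cl e f.
have wE z n : walk (wt J) (te n) (blk J.+1) z.1 * walk (wt J) (to n) (blk J.+1) z.2 =
  walk (wt2 J) (tc R n) (ncoord J) z by rewrite walk_wt2.
rewrite (wE (2, 2)) (wE (2, -2)) (wE (-2, 2)) (wE (-2, -2)) -!cl !mulr_sumr -!big_split/=.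
by apply: eq_bigr => p _; rewrite -!(wE (_, _))/=; ring.
Qed.

(* The two partial derivatives of the Dirac mass, in rescaled coordinates. *)
Definition T1 J m : R := (per J)%:R ^+ 3 * (A1 J m * B0 J m).
Definition T2 J m : R := (per J)%:R ^+ 3 * (A0 J m * B1 J m).

Lemma per_half J : 2 ^- J = 64 / (per J)%:R :> R.
Proof.
rewrite /per expnD natrM !natrX; field.
by rewrite !expf_neq0// pnatr_eq0.
Qed.

Local Notation b J := (2 * (64 / (per J)%:R)).

Let d0E J t : d0 J t = walk (wt J) t (blk J.+1) 2 + 1 * walk (wt J) t (blk J.+1) (-2).
Proof. by rewrite mul1r. Qed.

Let d1E J t : d1 J t = walk (wt J) t (blk J.+1) 2 + (-1) * walk (wt J) t (blk J.+1) (-2).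
Proof. by rewrite mulN1r. Qed.

(** [b J] is the value 2 * 2^-J of the coordinate at the point 2. On a pair of opposite points,
    multiplication by the coordinate turns a difference into [b J] times a sum, and a sum into [b J]
    times a difference. *)
Lemma F1_T1 J m : \sum_(p <- F1 J) p.1 * T1 J (p.2 + m) =
  (per J)%:R ^+ 3 * (b J * (A0 J m * B0 J m)).
Proof.
under eq_bigr do rewrite /T1 mulrCA /A1 /B0 d1E d0E.
rewrite -mulr_sumr (pairing_AB (pairing1 J m)) /A0 /B0 !d0E per_half.
by rewrite -[2%:~R]/(2 : R) -[(-2)%:~R]/(-2 : R); ring.
Qed.

Lemma F1_T2 J m : \sum_(p <- F1 J) p.1 * T2 J (p.2 + m) =
  (per J)%:R ^+ 3 * (b J * (A1 J m * B1 J m)).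
Proof.
under eq_bigr do rewrite /T2 mulrCA /A0 /B1 d1E d0E.
rewrite -mulr_sumr (pairing_AB (pairing1 J m)) /A1 /B1 !d1E per_half.
by rewrite -[2%:~R]/(2 : R) -[(-2)%:~R]/(-2 : R); ring.
Qed.

Lemma F2_T1 J m : \sum_(p <- F2 J) p.1 * T1 J (p.2 + m) =
  (per J)%:R ^+ 3 * (b J * (A1 J m * B1 J m)).
Proof.
under eq_bigr do rewrite /T1 mulrCA /A1 /B0 d1E d0E.
rewrite -mulr_sumr (pairing_AB (pairing2 J m)) /A1 /B1 !d1E per_half.
by rewrite -[2%:~R]/(2 : R) -[(-2)%:~R]/(-2 : R); ring.
Qed.

Lemma F2_T2 J m : \sum_(p <- F2 J) p.1 * T2 J (p.2 + m) =
  (per J)%:R ^+ 3 * (b J * (A0 J m * B0 J m)).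
Proof.
under eq_bigr do rewrite /T2 mulrCA /A0 /B1 d1E d0E.
rewrite -mulr_sumr (pairing_AB (pairing2 J m)) /A0 /B0 !d0E per_half.
by rewrite -[2%:~R]/(2 : R) -[(-2)%:~R]/(-2 : R); ring.
Qed.

Lemma TN J m : (T1 J (- m) = T1 J m) * (T2 J (- m) = T2 J m).
Proof.
have teN : te (- m) = te m by apply/funext => k; rewrite /te tcN.
have toN : to (- m) = to m by apply/funext => k; rewrite /to tcN.
by rewrite /T1 /T2 /A1 /A0 /B0 /B1 teN toN.
Qed.

(** A difference is O([per J]^-2) and a sum O([per J]^-1), which is exactly what the factor
    [per J]^3 compensates. *)
Lemma T_bounded : exists C : R, forall J m, `|T1 J m| <= C /\ `|T2 J m| <= C.
Proof.
set x : R := 2 * (1 + 6 * 16 ^+ 3); set y : R := 48 * 16 ^+ 3.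
exists (x * y) => J m.
have te1 k : `|te m k| <= 1 by exact: norm_tc.
have to1 k : `|to m k| <= 1 by exact: norm_tc.
have p0 : 0 < (per J)%:R :> R by rewrite ltr0n per_gt0.
have H (a c : R) : `|a| <= y / (per J)%:R ^+ 2 -> `|c| <= x / (per J)%:R ->
    `|(per J)%:R ^+ 3 * (a * c)| <= x * y.
  move=> ha hc; rewrite normrM ger0_norm ?exprn_ge0// normrM.
  apply: (@le_trans _ _ ((per J)%:R ^+ 3 * (y / (per J)%:R ^+ 2 * (x / (per J)%:R)))).
    by rewrite ler_wpM2l ?exprn_ge0//; apply: ler_pM.
  rewrite le_eqVlt; apply/orP; left; apply/eqP; field.
  exact: lt0r_neq0.
have [[[a0 a1] b0] b1] := (d0_le J te1, d1_le J te1, d0_le J to1, d1_le J to1).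
rewrite mulrA in a0; rewrite mulrA in b0.
split; first exact: H.
by rewrite /T2 (mulrC (A0 J m)); apply: H.
Qed.

(** These are the real and imaginary parts of (F1 + i F2)(T1 + i T2). The first vanishes
    identically; the second is [per J]^3 times [b J] times two differences, hence O([per J]^-2). *)
Lemma F_annihilate : exists C : R, forall J m,
  [/\ \sum_(p <- F1 J) p.1 * T1 J (p.2 + m) - \sum_(p <- F2 J) p.1 * T2 J (p.2 + m) = 0 &
  `|\sum_(p <- F1 J) p.1 * T2 J (p.2 + m) + \sum_(p <- F2 J) p.1 * T1 J (p.2 + m)|
   <= C / J.+1%:R].
Proof.
set y : R := 48 * 16 ^+ 3.
exists (256 * y ^+ 2) => J m; split; first by rewrite F1_T1 F2_T2 subrr.
have te1 k : `|te m k| <= 1 by exact: norm_tc.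
have to1 k : `|to m k| <= 1 by exact: norm_tc.
have p0 : 0 < (per J)%:R :> R by rewrite ltr0n per_gt0.
have a1 := d1_le J te1; have b1 := d1_le J to1.
rewrite F1_T2 F2_T1 addrr_mul2.
rewrite [X in `|X|](_ : _ = 2 * (per J)%:R ^+ 3 * 2 * 64 / (per J)%:R *
    (A1 J m * B1 J m)); last by ring.
rewrite normrM ger0_norm; last by rewrite !mulr_ge0// ?exprn_ge0// invr_ge0.
apply: (@le_trans _ _ (2 * (per J)%:R ^+ 3 * 2 * 64 / (per J)%:R *
    (y / (per J)%:R ^+ 2 * (y / (per J)%:R ^+ 2)))).
  rewrite ler_wpM2l ?mulr_ge0 ?exprn_ge0 ?invr_ge0// normrM.
  exact: ler_pM.
rewrite [leLHS](_ : _ = 256 * y ^+ 2 * ((per J)%:R ^+ 2)^-1); last first.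
  by field; exact: lt0r_neq0.
rewrite ler_wpM2l ?mulr_ge0 ?sqr_ge0//.
rewrite lef_pV2 ?posrE ?exprn_gt0 ?ltr0n ?per_gt0// -natrX ler_nat.
have JJ : (J < 2 ^ J)%N by exact: ltn_expl.
rewrite /per expnD expnS expn1; have : (0 < 2 ^ J)%N by rewrite expn_gt0.
nia.
Qed.

(** The constant is 2 p^3 (128/p) / (4p)^2 with p = [per J], from [d0_ge] in both components at m =
    0. *)
Lemma F_pairing J :
  16 <= \sum_(p <- F1 J) p.1 * T1 J p.2 + \sum_(p <- F2 J) p.1 * T2 J p.2.
Proof.
have := F1_T1 J 0; have := F2_T2 J 0.
under eq_bigr do rewrite addr0.
move=> ->; under eq_bigr do rewrite addr0.
move=> ->.
have te1 k : te 0 k = 1 by exact: tc0.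
have to1 k : to 0 k = 1 by exact: tc0.
have a0 := d0_ge J te1; have b0 := d0_ge J to1.
have p0 : 0 < (per J)%:R :> R by rewrite ltr0n per_gt0.
have i0 : 0 <= (4 * per J)%:R^-1 :> R by rewrite invr_ge0.
have h := ler_pM i0 i0 a0 b0.
rewrite -mulrDr addrr_mul2.
apply: (@le_trans _ _ ((per J)%:R ^+ 3 * (2 * (2 * (64 / (per J)%:R) *
   ((4 * per J)%:R^-1 * (4 * per J)%:R^-1))))).
  rewrite le_eqVlt; apply/orP; left; apply/eqP; rewrite natrM; field.
  exact: lt0r_neq0.
by rewrite ler_wpM2l ?exprn_ge0// ler_wpM2l// ler_wpM2l// mulr_ge0// divr_ge0.
Qed.

End Functional.

(** * Passage to the limit and to finitely supported functionals *)

Section Cutoff.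
Variable R : realType.
Implicit Types (T : int -> R) (L : nat).

Definition coef (l : seq (R * int)) (n : int) : R :=
  \sum_(p <- l) p.1 * (p.2 == n)%:R.

Definition zsum L (F : int -> R) : R := \sum_(i < (2 * L).+1) F (i%:Z - L%:Z).

Lemma eq_zsum L F F' : (forall n, F n = F' n) -> zsum L F = zsum L F'.
Proof. by move=> FF; apply: eq_bigr => i _; rewrite FF. Qed.

Lemma zsumD L F F' : zsum L (fun n => F n + F' n) = zsum L F + zsum L F'.
Proof. exact: big_split. Qed.

Lemma ler_norm_zsum L F : `|zsum L F| <= zsum L (fun n => `|F n|).
Proof. exact: ler_norm_sum. Qed.

Lemma ler_zsum L F F' : (forall n, F n <= F' n) -> zsum L F <= zsum L F'.
Proof. by move=> FF; apply: ler_sum => i _. Qed.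

Lemma zsumZ L c F : zsum L (fun n => c * F n) = c * zsum L F.
Proof. by rewrite /zsum mulr_sumr. Qed.

Lemma zsum_delta L (n : int) F : (forall n, (L < `|n|)%N -> F n = 0) ->
  zsum L (fun x => (n == x)%:R * F x) = F n.
Proof.
move=> F0; case: (leqP `|n| L) => nL; last first.
  rewrite F0//; apply: big1 => i _; case: eqP => [<-|_]; rewrite ?mul0r//.
  by rewrite F0// mulr0.
have iP : (`|(n + L%:Z)%R| < (2 * L).+1)%N by lia.
rewrite /zsum (bigD1 (Ordinal iP))//= big1 => [|i].
  have -> : `|(n + L%:Z)%R|%N%:Z - L%:Z = n by lia.
  by rewrite eqxx mul1r addr0.
rewrite -val_eqE/= => iN; case: eqP => [e|]; last by rewrite mul0r.
by move: iN; rewrite e; lia.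
Qed.

Lemma zsum_coef L l k T : (forall n, (L < `|n|)%N -> T n = 0) ->
  zsum L (fun n => coef l (n + k) * T n) = \sum_(p <- l) p.1 * T (p.2 - k).
Proof.
move=> T0; rewrite /zsum /coef.
under eq_bigr do rewrite mulr_suml.
rewrite exchange_big/=; apply: eq_bigr => p _.
rewrite -(zsum_delta (p.2 - k) T0) /zsum mulr_sumr; apply: eq_bigr => i _.
by rewrite -mulrA; congr (_ * (_%:R * _)); rewrite subr_eq.
Qed.

Lemma zsum_coef_norm L l k : zsum L (fun n => `|coef l (n + k)|) <= lnorm l.
Proof.
rewrite /lnorm.
apply: (@le_trans _ _ (zsum L (fun n => \sum_(p <- l) `|p.1| * (p.2 == n + k)%:R))).
  apply: ler_zsum => n; apply: le_trans (ler_norm_sum _ _ _) _.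
  by apply: ler_sum => p _; rewrite normrM normr_nat.
rewrite /zsum exchange_big/=; apply: ler_sum => p _.
rewrite -mulr_sumr ler_piMr//.
case: (boolP [exists i : 'I_((2 * L).+1), p.2 == i%:Z - L%:Z + k]) => [/existsP[i /eqP pi]|].
  rewrite (bigD1 i)//= pi eqxx big1 ?addr0// => j ji.
  by case: eqP => // e; move: ji; rewrite -val_eqE/=; lia.
rewrite negb_exists => /forallP H; rewrite big1// => i _.
by rewrite (negPf (H i)).
Qed.

(** Its slope 1/L makes multiplication by it almost commute with the convolution by a polynomial of
    degree small compared with L, so the annihilation survives the cutoff. *)
Definition tent L (n : int) : R := Num.max 0 (1 - `|n|%N%:R / L%:R).

Lemma tent_ge0 L n : 0 <= tent L n. Proof. by rewrite le_max lexx. Qed.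

Lemma tent_le1 L n : tent L n <= 1.
Proof. by rewrite ge_max ler01/= gerBl divr_ge0. Qed.

Lemma tentN L n : tent L (- n) = tent L n.
Proof. by rewrite /tent abszN. Qed.

Lemma tent0 L : tent L 0 = 1.
Proof. by rewrite /tent absz0 mul0r subr0; apply/max_idPr. Qed.

(** At L = 0 the division yields 0 and the tent is constantly 1. *)
Lemma tent_out L n : (0 < L < `|n|)%N -> tent L n = 0.
Proof.
move=> /andP[L0 Ln]; apply/max_idPl; rewrite subr_le0 ler_pdivlMr ?ltr0n//.
by rewrite mul1r ler_nat ltnW.
Qed.

Lemma tent_lipschitz L (n m : int) : (0 < L)%N ->
  `|tent L (n + m) - tent L m| <= `|n|%N%:R / L%:R.
Proof.
move=> L0; have L0' : 0 < L%:R :> R by rewrite ltr0n.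
have maxL (x y : R) : `|Num.max 0 x - Num.max 0 y| <= `|x - y|.
  rewrite ler_norml !maxEle.
  have := ler_norm (x - y); have := ler_norm (y - x); rewrite distrC => h1 h2.
  by case: (lerP 0 x) => hx; case: (lerP 0 y) => hy; apply/andP; split; lra.
apply: le_trans (maxL _ _) _.
rewrite opprB addrC addrA subrK -mulrBl normrM normfV normr_nat ler_wpM2r ?invr_ge0//.
have h1 : (`|(n + m)%R| <= `|n| + `|m|)%N by lia.
have h2 : (`|m| <= `|n| + `|(n + m)%R|)%N by lia.
rewrite -(ler_nat R) natrD in h1; rewrite -(ler_nat R) natrD in h2.
by rewrite ler_norml; apply/andP; split; lra.
Qed.

Lemma cutoff_pairing L l (D : nat) (C : R) T m : (0 < L)%N ->
  (forall p, p \in l -> (`|p.2| <= D)%N) -> (forall n, `|T n| <= C) ->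
  `|\sum_(p <- l) p.1 * (tent L (p.2 + m) * T (p.2 + m)) -
    tent L m * \sum_(p <- l) p.1 * T (p.2 + m)| <= lnorm l * (D%:R / L%:R * C).
Proof.
move=> L0 lD TC; rewrite mulr_sumr -sumrB /lnorm mulr_suml.
apply: le_trans (ler_norm_sum _ _ _) _.
rewrite !big_seq; apply: ler_sum => p pl.
rewrite (_ : _ - _ = p.1 * ((tent L (p.2 + m) - tent L m) * T (p.2 + m))); last by ring.
rewrite normrM ler_wpM2l// normrM; apply: ler_pM => //.
apply: le_trans (tent_lipschitz _ _ L0) _.
by rewrite ler_wpM2r ?invr_ge0// ler_nat lD.
Qed.

End Cutoff.

Section Limit.
Variable R : realType.
Variables (g : nat -> R) (A : R).
Hypothesis gA : forall K, \sum_(k < K) lnorm (finc g k) <= A.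

Lemma coef_cat (l l' : seq (R * int)) n : coef (l ++ l') n = coef l n + coef l' n.
Proof. by rewrite /coef big_cat. Qed.

Lemma norm_coef (l : seq (R * int)) n : `|coef l n| <= lnorm l.
Proof.
apply: le_trans (ler_norm_sum _ _ _) _; apply: ler_sum => p _.
by rewrite normrM normr_nat ler_piMr//; case: eqP.
Qed.

Lemma flist_add K M :
  exists2 l, flist g (K + M) = flist g K ++ l & lnorm l = \sum_(K <= k < K + M) lnorm (finc g k).
Proof.
elim: M => [|M [l fl ll]]; first by exists [::]; rewrite ?addn0 ?cats0// big_geq// /lnorm big_nil.
exists (l ++ finc g (K + M)); first by rewrite addnS flistS fl catA.
by rewrite addnS big_nat_recr ?leq_addr//= lnorm_cat ll.
Qed.

Definition mass (K : nat) : R := \sum_(0 <= k < K) lnorm (finc g k).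

Lemma mass_nd : {homo mass : m n / (m <= n)%N >-> m <= n}.
Proof.
move=> m n mn; rewrite /mass (@big_cat_nat _ _ _ m _ n)//= lerDl.
by apply: sumr_ge0 => i _; exact: lnorm_ge0.
Qed.

Lemma mass_le K : mass K <= A.
Proof. by rewrite /mass big_mkord. Qed.

Lemma mass_cvg : cvgn mass.
Proof.
apply: nondecreasing_is_cvgn; first exact: mass_nd.
by exists A => _ [K _ <-]; exact: mass_le.
Qed.

Lemma mass_lim K : mass K <= limn mass.
Proof. by apply: nondecreasing_cvgn_le; [exact: mass_nd|exact: mass_cvg]. Qed.

Lemma mass_tail (e : R) : 0 < e -> exists K0, forall K, (K0 <= K)%N -> limn mass - mass K <= e.
Proof.
move=> e0; have /cvgrPdist_le/(_ _ e0)[K0 _ H] := mass_cvg.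
by exists K0 => K KK; apply: le_trans (ler_norm _) _; exact: H.
Qed.

Lemma coef_flistE K n : coef (flist g K) n = series (fun k => coef (finc g k) n) K.
Proof.
elim: K => [|K IH]; first by rewrite /coef /series/= !big_nil.
by rewrite flistS coef_cat IH seriesSr.
Qed.

Lemma coef_cvg n : cvgn (fun K => coef (flist g K) n).
Proof.
have -> : (fun K => coef (flist g K) n) = series (fun k => coef (finc g k) n).
  by apply/funext => K; exact: coef_flistE.
apply: normed_cvg; apply: (series_le_cvg _ _ _ mass_cvg) => k /=.
- exact: normr_ge0.
- exact: lnorm_ge0.
- exact: norm_coef.
Qed.

Definition flim (n : int) : R := limn (fun K => coef (flist g K) n).

Lemma cvg_sum_ord N (F : nat -> nat -> R) (l : nat -> R) :
  (forall i, F i @ \oo --> l i) ->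
  (fun M => \sum_(i < N) F i M) @ \oo --> \sum_(i < N) l i.
Proof.
move=> Fl; elim: N => [|N IH].
  rewrite big_ord0 (_ : (fun _ => _) = cst 0); first exact: cvg_cst.
  by apply/funext => M; rewrite big_ord0.
rewrite big_ord_recr/= (_ : (fun _ => _) = (fun M => \sum_(i < N) F i M + F N M)).
  exact: cvgD.
by apply/funext => M; rewrite big_ord_recr.
Qed.

(** On a finite window the limit in M passes through the sum; the bound, the mass of the increments
    after K, depends neither on the window nor on the shift. *)
Lemma flim_dist L K k :
  zsum L (fun n => `|flim (n + k) - coef (flist g K) (n + k)|) <= limn mass - mass K.
Proof.
pose u M := zsum L (fun n => `|coef (flist g M) (n + k) - coef (flist g K) (n + k)|).
have cu : u @ \oo --> zsum L (fun n => `|flim (n + k) - coef (flist g K) (n + k)|).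
  apply: (cvg_sum_ord (l := fun i => `|flim (i%:Z - L%:Z + k) - coef (flist g K) (i%:Z - L%:Z + k)|)
    (F := fun i M => `|coef (flist g M) (i%:Z - L%:Z + k) - coef (flist g K) (i%:Z - L%:Z + k)|)) => i.
  by apply: cvg_norm; apply: cvgB; [exact: coef_cvg|exact: cvg_cst].
rewrite -(cvg_lim _ cu)//.
apply: limr_le; first by apply/cvg_ex; eexists; exact: cu.
near=> M.
have [M' ->] : exists M', M = (K + M')%N.
  by exists (M - K)%N; rewrite subnKC//; near: M; exact: nbhs_infty_ge.
have [l fl ll] := flist_add K M'.
rewrite /u fl.
apply: (@le_trans _ _ (lnorm l)).
  apply: le_trans (zsum_coef_norm L l k); apply: ler_zsum => n.
  by rewrite coef_cat (addrC (coef _ _)) addrK.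
rewrite lerBrDl ll; apply: le_trans (mass_lim (K + M')).
by rewrite /mass [leRHS](@big_cat_nat _ _ _ K _ (K + M'))//= leq_addr.
Unshelve. all: by end_near. Qed.

Lemma flim_norm L k : zsum L (fun n => `|flim (n + k)|) <= limn mass.
Proof.
have := flim_dist L 0 k; rewrite {2}/mass big_nil subr0.
by apply: le_trans; apply: ler_zsum => n; rewrite /coef big_nil subr0.
Qed.

End Limit.

Section Core.
Variable R : realType.

(** Two errors add up: the tail of the series beyond K, and the commutation of the tent with a
    polynomial of degree [deg K]. *)
Lemma flim_pairing (g : nat -> R) A K L T (C : R) k :
  (forall K, \sum_(k < K) lnorm (finc g k) <= A) ->
  (0 < L)%N -> (forall n, `|T n| <= C) ->
  `|zsum L (fun n => flim g (n + k) * (tent R L n * T n)) -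
    tent R L (- k) * \sum_(p <- flist g K) p.1 * T (p.2 - k)| <=
  C * (limn (mass g) - mass g K) + A * ((deg K)%:R / L%:R * C).
Proof.
move=> gA L0 TC.
have C0 : 0 <= C by apply: le_trans (TC 0); exact: normr_ge0.
have lA : lnorm (flist g K) <= A by rewrite lnorm_flist.
pose T' n := tent R L n * T n.
have T'0 n : (L < `|n|)%N -> T' n = 0 by move=> Ln; rewrite /T' tent_out ?mul0r// L0.
have T'C n : `|T' n| <= C.
  rewrite /T' normrM -[leRHS]mul1r; apply: ler_pM => //.
  by rewrite ger0_norm ?tent_ge0// tent_le1.
rewrite -[X in X - _](subrK (zsum L (fun n => coef (flist g K) (n + k) * T' n))) -addrA.
apply: le_trans (ler_normD _ _) _; apply: lerD.
  have -> : zsum L (fun n => flim g (n + k) * T' n) -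
      zsum L (fun n => coef (flist g K) (n + k) * T' n) =
      zsum L (fun n => (flim g (n + k) - coef (flist g K) (n + k)) * T' n).
    rewrite -mulN1r -zsumZ -zsumD; apply: eq_zsum => n; ring.
  apply: le_trans (ler_norm_zsum _ _) _.
  apply: le_trans (ler_wpM2l C0 (flim_dist gA L K k)).
  rewrite -zsumZ; apply: ler_zsum => n.
  by rewrite normrM mulrC ler_wpM2r.
rewrite zsum_coef//.
apply: le_trans (cutoff_pairing (D := deg K) (C := C) (- k) L0 _ TC) _.
  by move=> p /flist_deg.
by rewrite ler_wpM2r// mulr_ge0// divr_ge0.
Qed.

Lemma small_inv (x e : R) : 0 < e -> exists J0 : nat, forall J, (J0 <= J)%N -> x / J.+1%:R <= e.
Proof.
move=> e0; exists (Num.bound (x / e)) => J JJ.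
rewrite ler_pdivrMr ?ltr0n// -ler_pdivrMl// mulrC.
have [xe|xe] := lerP (x / e) 0; first exact: le_trans xe _.
apply: le_trans (ltW (archi_boundP (ltW xe))) _.
by rewrite ler_nat leqW.
Qed.

Lemma malliavin : exists (f1 f2 : int -> R) (A C : R) (L : nat -> nat) (T1 T2 : nat -> int -> R),
 [/\ forall N, zsum N (fun n => `|f1 n|) <= A /\ zsum N (fun n => `|f2 n|) <= A,
     forall J n, `|T1 J n| <= C /\ `|T2 J n| <= C,
     forall J n, T1 J (- n) = T1 J n /\ T2 J (- n) = T2 J n,
     forall e : R, 0 < e -> exists J0, forall J, (J0 <= J)%N -> forall k,
       `|zsum (L J) (fun n => f1 (n + k) * T1 J n) - zsum (L J) (fun n => f2 (n + k) * T2 J n)| <= e /\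
       `|zsum (L J) (fun n => f1 (n + k) * T2 J n) + zsum (L J) (fun n => f2 (n + k) * T1 J n)| <= e &
     exists J0, forall J, (J0 <= J)%N ->
       8 <= zsum (L J) (fun n => f1 n * T1 J n) + zsum (L J) (fun n => f2 n * T2 J n)].
Proof.
have [A1 gA1] := finc_summable (@sum_gam1 R).
have [A2 gA2] := finc_summable (@sum_gam2 R).
have [C TC] := T_bounded R.
have [C' FC'] := F_annihilate R.
(* The window exceeds J+1 times the degree, which brings the commutation error below a multiple of C
   / (J+1). *)
pose L J := (J.+1 * (deg (ncoord J)).+1)%N.
have L0 J : (0 < L J)%N by [].
have A10 : 0 <= A1 by apply: le_trans (gA1 0); rewrite big_ord0.
have A20 : 0 <= A2 by apply: le_trans (gA2 0); rewrite big_ord0.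
have C0 : 0 <= C by apply: le_trans (TC 0%N 0).1; exact: normr_ge0.
pose err J := C * (limn (mass (gam1 R)) - mass (gam1 R) (ncoord J)) +
  C * (limn (mass (gam2 R)) - mass (gam2 R) (ncoord J)) +
  A1 * (C / J.+1%:R) + A2 * (C / J.+1%:R).
have degL J : (deg (ncoord J))%:R / (L J)%:R * C <= C / J.+1%:R :> R.
  rewrite mulrC ler_wpM2l// /L natrM ler_pdivrMr ?mulr_gt0 ?ltr0n//.
  by rewrite mulKf ?pnatr_eq0// ler_nat.
have tail1 J : 0 <= C * (limn (mass (gam1 R)) - mass (gam1 R) (ncoord J)).
  by rewrite mulr_ge0// subr_ge0 (mass_lim gA1).
have tail2 J : 0 <= C * (limn (mass (gam2 R)) - mass (gam2 R) (ncoord J)).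
  by rewrite mulr_ge0// subr_ge0 (mass_lim gA2).
have aux (a b c d x : R) : x <= c -> 0 <= b -> 0 <= d -> a + x <= a + b + c + d.
  by move=> *; lra.
have aux' (a b c d x : R) : x <= d -> 0 <= a -> 0 <= c -> b + x <= a + b + c + d.
  by move=> *; lra.
have pair1 J T k : (forall n, `|T n| <= C) ->
    `|zsum (L J) (fun n => flim (gam1 R) (n + k) * (tent R (L J) n * T n)) -
      tent R (L J) (- k) * \sum_(p <- F1 R J) p.1 * T (p.2 - k)| <= err J.
  move=> TC'; apply: le_trans (flim_pairing (ncoord J) k gA1 (L0 J) TC') _.
  by apply: aux; rewrite ?tail2 ?ler_wpM2l ?degL// mulr_ge0// divr_ge0.
have pair2 J T k : (forall n, `|T n| <= C) ->
    `|zsum (L J) (fun n => flim (gam2 R) (n + k) * (tent R (L J) n * T n)) -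
      tent R (L J) (- k) * \sum_(p <- F2 R J) p.1 * T (p.2 - k)| <= err J.
  move=> TC'; apply: le_trans (flim_pairing (ncoord J) k gA2 (L0 J) TC') _.
  by apply: aux'; rewrite ?tail1 ?ler_wpM2l ?degL// mulr_ge0// divr_ge0.
have JK J : (J <= ncoord J)%N by rewrite /ncoord /blk; lia.
have err0 (e : R) : 0 < e -> exists J0, forall J, (J0 <= J)%N -> err J <= e.
  move=> e0; have C1 : 0 < C + 1 by lra.
  have e3 : 0 < e / 3 / (C + 1) by rewrite !divr_gt0.
  have [K1 H1] := mass_tail gA1 e3; have [K2 H2] := mass_tail gA2 e3.
  have [K3 H3] := small_inv ((A1 + A2) * C) (divr_gt0 e0 (ltr0n _ 3)).
  exists (maxn K1 (maxn K2 K3)) => J; rewrite !geq_max => /and3P[J1 J2 J3].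
  have h (x : R) : x <= e / 3 / (C + 1) -> C * x <= e / 3.
    move=> xe; apply: le_trans (ler_wpM2l C0 xe) _.
    rewrite mulrCA -[leRHS]mulr1 ler_wpM2l ?divr_ge0 ?ltW//.
    by rewrite ltr_pdivrMr//; lra.
  have aux3 (a b c d : R) : a <= d / 3 -> b <= d / 3 -> c <= d / 3 -> a + b + c <= d.
    by move=> *; lra.
  have -> : err J = C * (limn (mass (gam1 R)) - mass (gam1 R) (ncoord J)) +
    C * (limn (mass (gam2 R)) - mass (gam2 R) (ncoord J)) + (A1 + A2) * C / J.+1%:R.
    by rewrite /err; ring.
  apply: aux3; [apply: h|apply: h|exact: H3].
    exact: H1 (leq_trans J1 (JK J)).
  exact: H2 (leq_trans J2 (JK J)).
clearbody err.
exists (flim (gam1 R)), (flim (gam2 R)), (Num.max (limn (mass (gam1 R))) (limn (mass (gam2 R)))), C, L,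
  (fun J n => tent R (L J) n * T1 R J n), (fun J n => tent R (L J) n * T2 R J n).
have tentT J n (x : R) : `|x| <= C -> `|tent R (L J) n * x| <= C.
  move=> xC; rewrite normrM -[leRHS]mul1r; apply: ler_pM => //.
  by rewrite ger0_norm ?tent_ge0// tent_le1.
split.
- move=> N; split; rewrite le_max; apply/orP; [left|right].
    have := flim_norm gA1 N 0; apply: le_trans.
    by apply: ler_zsum => n; rewrite addr0.
  have := flim_norm gA2 N 0; apply: le_trans.
  by apply: ler_zsum => n; rewrite addr0.
- by move=> J n; split; apply: tentT; have [] := TC J n.
- by move=> J n; rewrite tentN !TN.
- move=> e e0; have [J1 H1] := err0 (e / 4) (divr_gt0 e0 (ltr0n _ 4)).
  have [J2 H2] := small_inv C' (divr_gt0 e0 (ltr0n _ 4)).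
  exists (maxn J1 J2) => J; rewrite geq_max => /andP[/H1 {}H1 /H2 {}H2] k.
  have [z0 zC] := FC' J (- k).
  have h1 := pair1 J (T1 R J) k (fun n => (TC J n).1).
  have h2 := pair1 J (T2 R J) k (fun n => (TC J n).2).
  have h3 := pair2 J (T1 R J) k (fun n => (TC J n).1).
  have h4 := pair2 J (T2 R J) k (fun n => (TC J n).2).
  have t0 := tent_ge0 R (L J) (- k); have t1 := tent_le1 R (L J) (- k).
  move: h1 h2 h3 h4 z0 zC.
  set z1 := zsum _ _; set z2 := zsum _ _; set z3 := zsum _ _; set z4 := zsum _ _.
  set s1 := \sum_(_ <- _) _; set s2 := \sum_(_ <- _) _.
  set s3 := \sum_(_ <- _) _; set s4 := \sum_(_ <- _) _.
  set t := tent _ _ _ in t0 t1 *.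
  move=> h1 h2 h3 h4 z0 zC; split.
    have -> : z1 - z4 = (z1 - t * s1) - (z4 - t * s4) + t * (s1 - s4) by ring.
    rewrite z0 mulr0 addr0; apply: le_trans (ler_normB _ _) _; lra.
  have -> : z2 + z3 = (z2 - t * s2) + (z3 - t * s3) + t * (s2 + s3) by ring.
  apply: le_trans (ler_normD _ _) _.
  have ts : `|t * (s2 + s3)| <= C' / J.+1%:R.
    by rewrite normrM; apply: le_trans zC; rewrite ler_piMl// ger0_norm.
  have fin (a b u1 u2 v w d : R) : a <= u1 + u2 -> u1 <= v -> u2 <= v -> b <= w ->
      v <= d / 4 -> w <= d / 4 -> 0 < d -> a + b <= d by move=> *; lra.
  exact: (fin _ _ _ _ _ _ _ (ler_normD _ _) h2 h3 ts H1 H2 e0).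
- have [J1 H1] := err0 1 ltr01; exists J1 => J /H1 {}H1.
  have h1 := pair1 J (T1 R J) 0 (fun n => (TC J n).1).
  have h4 := pair2 J (T2 R J) 0 (fun n => (TC J n).2).
  have := F_pairing R J.
  rewrite oppr0 tent0 !mul1r in h1 h4.
  have e0 (F : int -> R) (l : seq (R * int)) : \sum_(p <- l) p.1 * F (p.2 - 0) = \sum_(p <- l) p.1 * F p.2.
    by under eq_bigr do rewrite subr0.
  rewrite !e0 in h1 h4.
  have e1 (F G : int -> R) N : zsum N (fun n => F (n + 0) * G n) = zsum N (fun n => F n * G n).
    by apply: eq_zsum => n; rewrite addr0.
  rewrite (e1 _ (fun n => tent R (L J) n * T1 R J n)) in h1.
  rewrite (e1 _ (fun n => tent R (L J) n * T2 R J n)) in h4.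
  move: h1 h4; rewrite !ler_norml => /andP[h1 _] /andP[h4 _]; lra.
Qed.

End Core.

(** * The Banach algebra of the action *)

Section CplxNorm.
Variable R : realType.
Local Notation C := (Cplx R).
Implicit Types x y : C.

Definition nrm x : R := complex.Re `|x|.

Lemma nrmE x : `|x| = (nrm x)%:C%C.
Proof. by rewrite /nrm RRe_real// ger0_real. Qed.

Lemma nrm_ge0 x : 0 <= nrm x.
Proof. by rewrite -lecR -nrmE; exact: normr_ge0. Qed.

Lemma nrm0 : nrm 0 = 0.
Proof. by rewrite /nrm normr0. Qed.

Lemma nrmD x y : nrm (x + y) <= nrm x + nrm y.
Proof. by rewrite -lecR rmorphD/= -!nrmE ler_normD. Qed.

Lemma nrmM x y : nrm (x * y) = nrm x * nrm y.
Proof. by apply: complexI; rewrite rmorphM/= -!nrmE normrM. Qed.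

Lemma nrmN x : nrm (- x) = nrm x.
Proof. by rewrite /nrm normrN. Qed.

Lemma nrm_sub x y z : nrm (x - z) <= nrm (x - y) + nrm (y - z).
Proof. by have := nrmD (x - y) (y - z); rewrite addrA subrK. Qed.

Lemma nrm_distC x y : nrm (x - y) = nrm (y - x).
Proof. by rewrite -nrmN opprB. Qed.

Lemma nrm_eq0 x : nrm x <= 0 -> x = 0.
Proof.
move=> x0; apply/eqP; rewrite -normr_eq0 nrmE.
by have -> : nrm x = 0 by apply/eqP; rewrite eq_le x0 nrm_ge0.
Qed.

Lemma nrm_sum (I : Type) (r : seq I) (P : pred I) (F : I -> C) :
  nrm (\sum_(i <- r | P i) F i) <= \sum_(i <- r | P i) nrm (F i).
Proof.
elim/big_rec2: _ => [|i y1 y2 _ le12]; first by rewrite nrm0.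
by apply: le_trans (nrmD _ _) _; rewrite lerD2l.
Qed.

Lemma nrmEsqrt x : nrm x = Num.sqrt (complex.Re x ^+ 2 + complex.Im x ^+ 2).
Proof. by rewrite /nrm normc_def. Qed.

Lemma nrm_real (r : R) : nrm (r%:C%C : C) = `|r|.
Proof. by rewrite nrmEsqrt/= expr0n/= addr0 sqrtr_sqr. Qed.

Lemma nrm_conj x : nrm x^* = nrm x.
Proof. by rewrite /nrm norm_conjC. Qed.

Lemma Re_le_nrm x : `|complex.Re x| <= nrm x.
Proof.
rewrite nrmEsqrt; case: x => a b /=.
by rewrite -sqrtr_sqr ler_wsqrtr// lerDl sqr_ge0.
Qed.

Lemma Im_le_nrm x : `|complex.Im x| <= nrm x.
Proof.
rewrite nrmEsqrt; case: x => a b /=.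
by rewrite -sqrtr_sqr ler_wsqrtr// lerDr sqr_ge0.
Qed.

Lemma nrm_le_ReIm x : nrm x <= `|complex.Re x| + `|complex.Im x|.
Proof.
rewrite nrmEsqrt; case: x => a b /=.
rewrite -[leRHS]ger0_norm ?addr_ge0// -sqrtr_sqr ler_wsqrtr//.
rewrite sqrrD !real_normK ?num_real//.
by rewrite addrAC lerDl mulrn_wge0// mulr_ge0.
Qed.

Lemma conj_mul x : x * x^* = (nrm x ^+ 2)%:C%C.
Proof. by rewrite -normCK nrmE rmorphXn. Qed.

Lemma Cplx_gt0 (e : C) : 0 < e -> exists2 r : R, 0 < r & e = r%:C%C.
Proof.
move=> e0; exists (complex.Re e); last by rewrite RRe_real// gtr0_real.
by move: e0; rewrite ltcE/= => /andP[].
Qed.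

Lemma entourage_nrm (E : set (C * C)) : entourage E <->
  exists2 e : R, 0 < e & forall x y, nrm (x - y) < e -> E (x, y).
Proof.
rewrite -entourage_ballE; split => [[e /= e0 eE]|[e e0 eE]].
  have [r r0 er] := Cplx_gt0 e0; exists r => // x y xy; apply: eE => /=.
  by rewrite -ball_normE/= er nrmE ltcR.
exists (e%:C%C); first by rewrite /= ltcR.
by move=> [x y]/=; rewrite -ball_normE/= nrmE ltcR => /eE.
Qed.

End CplxNorm.

Section Topological.
Variables (R : realType) (X : topologicalType).
Local Notation C := (Cplx R).

Lemma continuousPnrm (h : X -> C) : continuous h <->
  forall x (e : R), 0 < e -> \forall y \near x, nrm (h x - h y) < e.
Proof.
split => [ch x e e0|H x].
  have /cvgrPdist_lt/(_ (e%:C%C)) := ch x; rewrite ltcR => /(_ e0).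
  by apply: filterS => y; rewrite nrmE ltcR.
apply/cvgrPdist_lt => e e0; have [r r0 ->] := Cplx_gt0 e0.
by have := H x r r0; apply: filterS => y; rewrite nrmE ltcR.
Qed.

Lemma continuous_nrm (h : X -> C) : continuous h -> continuous (fun x => nrm (h x) : R^o).
Proof.
move=> /continuousPnrm ch x; apply/cvgrPdist_lt => e e0.
apply: filterS (ch x e e0) => y; apply: le_lt_trans.
have h1 := nrm_sub (h x) (h y) 0; have h2 := nrm_sub (h y) (h x) 0.
rewrite !subr0 (nrm_distC (h y)) in h1 h2.
by rewrite ler_norml; apply/andP; split; lra.
Qed.

Lemma continuous_conj (h : X -> C) : continuous h -> continuous (fun x => (h x)^* : C).
Proof.
move=> /continuousPnrm ch; apply/continuousPnrm => x e e0.
by apply: filterS (ch x e e0) => y; rewrite -rmorphB nrm_conj.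
Qed.

Lemma continuous_ofreal (h : X -> R) : continuous h -> continuous (fun x => (h x)%:C%C : C).
Proof.
move=> ch; apply/continuousPnrm => x e e0.
have /cvgrPdist_lt/(_ e e0) := ch x.
by apply: filterS => y; rewrite -rmorphB nrm_real.
Qed.

Lemma continuousDC (h k : X -> C) : continuous h -> continuous k ->
  continuous (fun x => h x + k x).
Proof. by move=> ch ck x; apply: cvgD; [exact: ch|exact: ck]. Qed.

Lemma continuousMC (h k : X -> C) : continuous h -> continuous k ->
  continuous (fun x => h x * k x).
Proof. by move=> ch ck x; apply: cvgM; [exact: ch|exact: ck]. Qed.

Lemma continuous_sumC (I : Type) (r : seq I) (h : I -> X -> C) :
  (forall i, continuous (h i)) -> continuous (fun x => \sum_(i <- r) h i x).
Proof.
move=> ch; elim: r => [|i r IH].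
  rewrite (_ : (fun x => _) = cst 0); first exact: cst_continuous.
  by apply/funext => x; rewrite big_nil.
rewrite (_ : (fun x => _) = (fun x => h i x + \sum_(j <- r) h j x)).
  by apply: continuousDC; [exact: ch|exact: IH].
by apply/funext => x; rewrite big_cons.
Qed.

Lemma continuous_unif (h : X -> C) :
  (forall e : R, 0 < e -> exists2 k : X -> C, continuous k & forall x, nrm (h x - k x) <= e) ->
  continuous h.
Proof.
move=> H; apply/continuousPnrm => x e e0.
have [k /continuousPnrm ck hk] := H (e / 4) (divr_gt0 e0 (ltr0n _ 4)).
apply: filterS (ck x (e / 4) (divr_gt0 e0 (ltr0n _ 4))) => y kxy.
have := hk x; have := hk y; rewrite (nrm_distC (h y)).
have := nrm_sub (h x) (k x) (h y); have := nrm_sub (k x) (k y) (h y); lra.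
Qed.

Hypothesis cX : compact [set: X].

Definition bounded_by (h : X -> C) (M : R) := forall x, nrm (h x) <= M.

Lemma continuous_bounded (h : X -> C) : continuous h -> exists M, bounded_by h M.
Proof.
move=> /continuous_nrm ch.
have := @continuous_compact X R^o (fun x => nrm (h x)) setT (continuous_subspaceT ch) cX.
move=> /compact_bounded[M [_ /(_ (M + 1))]].
rewrite ltrDl ltr01 => /(_ isT) HM; exists (M + 1) => x.
have := HM (nrm (h x)); rewrite /= ger0_norm ?nrm_ge0//; apply.
by exists x.
Qed.

Lemma nrm_le_sup (h : X -> C) x : continuous h -> nrm (h x) <= sup_norm h.
Proof.
move=> /continuous_bounded[M hM]; apply: ub_le_sup; last by exists x.
by exists M => _ [y _ <-]; exact: hM.
Qed.

End Topological.

Section SupNorm.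
Variable R : realType.
Local Notation C := (Cplx R).

Lemma sup_norm_le (X : topologicalType) (h : X -> C) (M : R) :
  0 <= M -> (forall x, nrm (h x) <= M) -> sup_norm h <= M.
Proof.
move=> M0 hM; have [[x _]|/set0P/negP/negPn/eqP X0] := pselect ([set: X] !=set0).
  by apply: ge_sup; [exists (nrm (h x)), x|move=> _ [y _ <-]; exact: hM].
by rewrite /sup_norm X0 image_set0 sup0.
Qed.

Lemma sup_norm_ge0 (X : topologicalType) (h : X -> C) : 0 <= sup_norm h.
Proof.
rewrite /sup_norm; set S := (X in sup X); have [hS|/sup_out hS] := pselect (has_sup S); last first.
  by rewrite hS.
case: hS => -[z [x hx zx]] hub.
by apply: le_trans (nrm_ge0 (h x)) _; apply: ub_le_sup => //; exists x.
Qed.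

End SupNorm.

Section CrossedProduct.
Variables (R : realType) (G : groupType) (X : topologicalType) (sigma : G -> X -> X).
Local Notation C := (Cplx R).
Hypothesis cX : compact [set: X].
Implicit Types (f g a b : G -> X -> C) (s t r : G) (x y : X) (A B : {fset G}).

#[local] Existing Instance totally_filter.

(** A real-valued substitute for bounds on the extended-real [l1_norm], see [l1_normP]. *)
Definition l1le f (M : R) := forall A, \sum_(t <- A) sup_norm (f t) <= M.

Lemma l1_normP f (M : R) : (l1_norm f <= M%:E)%E <-> l1le f M.
Proof.
have sumE A : (\sum_(t \in [set` A]) (sup_norm (f t))%:E)%E = (\sum_(t <- A) sup_norm (f t))%:E.
  rewrite fsbig_finite//= set_fsetK sumEFin.
  by [].
split => [fM A|H].
  rewrite -lee_fin -sumE; apply: le_trans fM; apply: ereal_sup_ubound.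
  by exists [set` A] => //; split.
apply: ge_ereal_sup => _ [A [fA _] <-].
by have := sumE (fset_set A); rewrite fset_setK// => ->; rewrite lee_fin.
Qed.

Lemma l1_norm_ge0 f : (0 <= l1_norm f)%E.
Proof. by apply: esum_ge0 => s _; rewrite lee_fin sup_norm_ge0. Qed.

Lemma ell1P f : ell1 f <-> (forall s, continuous (f s)) /\ exists M, l1le f M.
Proof.
split => -[cf].
  move=> fM; split=> //; exists (fine (l1_norm f)); apply/l1_normP.
  by rewrite fineK// fin_real// fM (lt_le_trans _ (l1_norm_ge0 f)).
by move=> [M /l1_normP fM]; split => //; exact: le_lt_trans fM (ltry M).
Qed.

Lemma l1le_ge0 f M : l1le f M -> 0 <= M.
Proof. by move=> /(_ fset0); rewrite big_seq_fset0. Qed.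

Lemma sup_le_l1 f M s : l1le f M -> sup_norm (f s) <= M.
Proof. by move=> /(_ [fset s]%fset); rewrite big_seq_fset1. Qed.

Lemma sum_seq_l1 f M (r : seq G) : l1le f M -> uniq r -> \sum_(t <- r) sup_norm (f t) <= M.
Proof.
move=> fM ur; apply: le_trans (fM [fset t in r]%fset).
rewrite le_eqVlt; apply/orP; left; apply/eqP; apply: perm_big.
apply: uniq_perm => //; first exact: fset_uniq.
by move=> t; rewrite !inE.
Qed.

Lemma l1_tail f M (e : R) : l1le f M -> 0 < e ->
  exists A, forall r : seq G, uniq r -> {in r, forall t, t \notin A} ->
    \sum_(t <- r) sup_norm (f t) <= e.
Proof.
move=> fM e0; pose E := [set (\sum_(t <- A) sup_norm (f t)) | A in [set: {fset G}]].
have supE : has_sup E.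
  by split; [exists (\sum_(t <- fset0) sup_norm (f t)), fset0|exists M => _ [A _ <-]].
have [_ [A _ <-] hA] := sup_adherent e0 supE.
exists A => r ur rA; rewrite -(lerD2l (\sum_(t <- A) sup_norm (f t))).
apply: (@le_trans _ _ (sup E)); last by rewrite -lerBlDr ltW.
rewrite -big_cat/=.
have u : uniq (A ++ r).
  rewrite cat_uniq fset_uniq ur andbT/=; apply/hasPn => t tr /=; exact: rA.
move: u; set l : seq G := (_ ++ r) => u; clearbody l.
rewrite (_ : \sum_(t <- l) _ = \sum_(t <- [fset t in l]%fset) sup_norm (f t)).
  by apply: ub_le_sup; [exact: supE.2|exists [fset t in l]%fset].
by apply: perm_big; apply: (uniq_perm u (fset_uniq _)) => t; rewrite !inE.
Qed.

Lemma nrm_le_supf f s x : ell1 f -> nrm (f s x) <= sup_norm (f s).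
Proof. by move=> [cf _]; exact: nrm_le_sup. Qed.

Lemma partial_sumE (u : G -> X -> C) A x : partial_sum u A x = \sum_(t <- A) u t x.
Proof.
rewrite /partial_sum -(big_seq_fsetE _ _ xpredT u)/=.
by elim/big_rec2: _ => // t z w _ <-.
Qed.

Lemma uniform_cvgP (u : G -> X -> C) (h : X -> C) :
  {uniform, partial_sum u @ totally --> h} <->
  (forall e : R, 0 < e -> exists A, forall B, (A `<=` B)%fset ->
     forall x, nrm (h x - \sum_(t <- B) u t x) < e).
Proof.
split => [H e e0|H P /uniform_nbhs[E [/entourage_nrm[e e0 eE] EP]]].
  have /H : nbhs (h : {uniform` [set: X] -> C}) [set k | forall x, nrm (h x - k x) < e].
    apply/uniform_nbhs; exists [set z | nrm (z.1 - z.2) < e]; split.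
      by apply/entourage_nrm; exists e.
    by move=> k /= hk x; exact: hk.
  move=> [A _ HA]; exists A => B AB x; have := HA B AB x.
  by rewrite partial_sumE.
have [A HA] := H e e0; exists A => // B AB; apply: EP => x _.
by apply: eE; rewrite partial_sumE; exact: HA.
Qed.

Lemma cvg_totally_real (v : G -> R) :
  (forall e : R, 0 < e -> exists A, forall B B', (A `<=` B)%fset -> (A `<=` B')%fset ->
     `|\sum_(t <- B) v t - \sum_(t <- B') v t| <= e) ->
  exists l : R, forall e, 0 < e -> exists A, forall B, (A `<=` B)%fset ->
     `|l - \sum_(t <- B) v t| <= e.
Proof.
move=> H; pose S (A : {fset G}) : R^o := \sum_(t <- A) v t.
have : cvg (S @ totally).
  apply/cauchy_cvgP/cauchyP => e e0.
  have [A HA] := H (e / 2) (divr_gt0 e0 (ltr0n _ 2)).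
  exists (S A); exists A => // B AB /=; rewrite /ball/=.
  by apply: le_lt_trans (HA A B (fsubset_refl _) AB) _; lra.
move=> /cvg_ex[/= l Sl]; exists l => e e0.
have /cvgrPdist_le/(_ e e0)[A _ HA] := Sl.
by exists A => B AB; exact: HA.
Qed.

(** The real and imaginary parts converge pointwise, and the Cauchy condition makes the limit
    uniform. A uniform limit thus exists, so [uniform_sum] is such a limit and not its default
    value. *)
Lemma uniform_sum_cvg (u : G -> X -> C) :
  (forall e : R, 0 < e -> exists A, forall B B', (A `<=` B)%fset -> (A `<=` B')%fset ->
     forall x, nrm (\sum_(t <- B) u t x - \sum_(t <- B') u t x) <= e) ->
  forall e : R, 0 < e -> exists A, forall B, (A `<=` B)%fset ->
     forall x, nrm (uniform_sum u x - \sum_(t <- B) u t x) <= e.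
Proof.
move=> H.
have Re_sum (r : seq G) x : complex.Re (\sum_(t <- r) u t x) = \sum_(t <- r) complex.Re (u t x).
  by elim/big_rec2: _ => // t z w _ <-; case: (u t x) => ? ?; case: w.
have Im_sum (r : seq G) x : complex.Im (\sum_(t <- r) u t x) = \sum_(t <- r) complex.Im (u t x).
  by elim/big_rec2: _ => // t z w _ <-; case: (u t x) => ? ?; case: w.
have ReB (z w : C) : complex.Re (z - w) = complex.Re z - complex.Re w by case: z; case: w.
have ImB (z w : C) : complex.Im (z - w) = complex.Im z - complex.Im w by case: z; case: w.
have hx x : exists l : C, forall e, 0 < e -> exists A, forall B, (A `<=` B)%fset ->
    nrm (l - \sum_(t <- B) u t x) <= e.
  have [e e0|l1 L1] := @cvg_totally_real (fun t => complex.Re (u t x)).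
    have [A HA] := H e e0; exists A => B B' AB AB'; rewrite -!Re_sum -ReB.
    exact: le_trans (Re_le_nrm _) (HA B B' AB AB' x).
  have [e e0|l2 L2] := @cvg_totally_real (fun t => complex.Im (u t x)).
    have [A HA] := H e e0; exists A => B B' AB AB'; rewrite -!Im_sum -ImB.
    exact: le_trans (Im_le_nrm _) (HA B B' AB AB' x).
  exists (l1 +i* l2)%C => e e0.
  have e2 : 0 < e / 2 by rewrite divr_gt0.
  have [A1 H1] := L1 _ e2; have [A2 H2] := L2 _ e2.
  exists (A1 `|` A2)%fset => B; rewrite fsubUset => /andP[/H1 {}H1 /H2 {}H2].
  apply: le_trans (nrm_le_ReIm _) _; rewrite ReB ImB Re_sum Im_sum/=.
  by have := lerD H1 H2; lra.
pose h x := projT1 (cid (hx x)).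
have hP : {uniform, partial_sum u @ totally --> h}.
  apply/uniform_cvgP => e e0; have e3 : 0 < e / 3 by rewrite divr_gt0.
  have [A HA] := H _ e3; exists A => B AB x.
  have [A' HA'] := projT2 (cid (hx x)) _ e3.
  have h1 := HA' (A `|` A')%fset (fsubsetUr _ _).
  have h2 := HA (A `|` A')%fset B (fsubsetUl _ _) AB x.
  have := nrm_sub (h x) (\sum_(t <- (A `|` A')%fset) u t x) (\sum_(t <- B) u t x).
  by rewrite /h in h1 *; lra.
have := xgetPex (fun=> 0) (ex_intro (fun h => {uniform, partial_sum u @ totally --> h}) h hP).
rewrite -/(uniform_sum u) => /uniform_cvgP uP e e0.
have [A HA] := uP e e0; exists A => B AB x; exact: ltW (HA B AB x).
Qed.

(** The tail of f controls the remainder, g being bounded by its norm. Products are handled below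
    through these finite sums. *)
Lemma l1_mul_approx f g s (e : R) : ell1 f -> ell1 g -> 0 < e ->
  exists A, forall B, (A `<=` B)%fset -> forall x,
    nrm (l1_mul sigma f g s x -
      \sum_(t <- B) f t x * g (t^-1 * s)%g (sigma t^-1%g x)) <= e.
Proof.
move=> ef eg; move: e; apply: uniform_sum_cvg => e e0.
have /ell1P[_ [M fM]] := ef; have /ell1P[_ [N gN]] := eg.
have N0 := l1le_ge0 gN.
have e1 : 0 < e / 2 / (N + 1) by rewrite !divr_gt0//; lra.
have [A HA] := l1_tail fM e1; exists A.
have key B : (A `<=` B)%fset -> forall x,
   nrm (\sum_(t <- B) f t x * translate sigma t (g (t^-1 * s)%g) x -
        \sum_(t <- A) f t x * translate sigma t (g (t^-1 * s)%g) x) <= e / 2.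
  move=> AB x; rewrite (bigID (mem A))/=.
  rewrite (_ : \sum_(t <- B | t \in A) _ = \sum_(t <- A) f t x * translate sigma t (g (t^-1 * s)%g) x); last first.
    rewrite -big_filter; apply: perm_big; apply: uniq_perm.
    - by rewrite filter_uniq ?fset_uniq.
    - exact: fset_uniq.
    - move=> t; rewrite mem_filter; case: (boolP (t \in A)) => //= tA.
      by rewrite (fsubsetP AB).
  rewrite addrAC subrr add0r -big_filter; apply: le_trans (nrm_sum _ _ _) _.
  apply: (@le_trans _ _ (\sum_(t <- [seq t <- B | t \notin A]) sup_norm (f t) * N)).
    apply: ler_sum => t _; rewrite nrmM; apply: ler_pM; rewrite ?nrm_ge0//.
      exact: nrm_le_supf.
    by apply: le_trans (nrm_le_supf _ _ eg) _; exact: sup_le_l1.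
  rewrite -mulr_suml.
  have := HA [seq t <- B | t \notin A] (filter_uniq _ (fset_uniq _)).
  move=> /(_ _)/le_trans h.
  apply: le_trans (ler_wpM2r N0 (h _ _ (lexx _))) _.
    by move=> t; rewrite mem_filter => /andP[].
  rewrite -[leRHS]mulr1 mulrAC -mulrA ler_wpM2l ?divr_ge0 ?ltW//.
  by rewrite ltr_pdivrMr//; lra.
move=> B B' AB AB' x; have h1 := key B AB x; have h2 := key B' AB' x.
set s0 := \sum_(t <- A) _ in h1 h2.
have := nrm_sub (\sum_(t <- B) f t x * translate sigma t (g (t^-1 * s)%g) x) s0
  (\sum_(t <- B') f t x * translate sigma t (g (t^-1 * s)%g) x).
by rewrite (nrm_distC s0); lra.
Qed.

End CrossedProduct.

Section Ell1Algebra.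
Variables (R : realType) (G : groupType) (X : topologicalType) (sigma : G -> X -> X).
Local Notation C := (Cplx R).
Hypothesis cX : compact [set: X].
Implicit Types (f g a b : G -> X -> C) (s t r : G) (x y : X) (A B : {fset G}).

Lemma nrm_small_eq0 (z : C) : (forall e : R, 0 < e -> nrm z <= e) -> z = 0.
Proof. by move=> H; apply: nrm_eq0; apply/ler_addgt0Pr => e e0; rewrite add0r H. Qed.

Lemma l1_mul_single f g s t0 x : ell1 f -> ell1 g ->
  (forall t, t != t0 -> f t x * g (t^-1 * s)%g (sigma t^-1%g x) = 0) ->
  l1_mul sigma f g s x = f t0 x * g (t0^-1 * s)%g (sigma t0^-1%g x).
Proof.
move=> ef eg H; apply/subr0_eq; apply: nrm_small_eq0 => e e0.
have [A HA] := @l1_mul_approx R G X sigma cX f g s e ef eg e0.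
have := HA (A `|` [fset t0])%fset (fsubsetUl _ _) x.
rewrite (bigD1_seq t0) ?fset_uniq ?inE ?eqxx ?orbT//= big1_seq ?addr0// => t /andP[tt0 _].
exact: H.
Qed.

Lemma common_fset (T : eqType) (r : seq T) (P : T -> {fset G} -> Prop) :
  (forall i B B', (B `<=` B')%fset -> P i B -> P i B') ->
  (forall i, exists B, P i B) -> exists B, forall i, i \in r -> P i B.
Proof.
move=> Pm Pe; elim: r => [|i r [B HB]]; first by exists fset0.
have [B' PB'] := Pe i; exists (B `|` B')%fset => j; rewrite inE => /predU1P[->|jr].
  exact: Pm (fsubsetUr _ _) PB'.
exact: Pm (fsubsetUl _ _) (HB j jr).
Qed.

Lemma l1_mul_approx_seq (T : eqType) (l : seq T) (k : T -> G) f g (e : R) :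
  ell1 f -> ell1 g -> 0 < e ->
  exists A, forall i, i \in l -> forall B, (A `<=` B)%fset -> forall x,
    nrm (l1_mul sigma f g (k i) x -
      \sum_(t <- B) f t x * g (t^-1 * k i)%g (sigma t^-1%g x)) <= e.
Proof.
move=> ef eg e0; apply: (@common_fset T l (fun i A => forall B, (A `<=` B)%fset -> forall x,
    nrm (l1_mul sigma f g (k i) x -
      \sum_(t <- B) f t x * g (t^-1 * k i)%g (sigma t^-1%g x)) <= e)).
  by move=> i B B' BB' H D BD; apply: H; exact: fsubset_trans BD.
by move=> i; exact: l1_mul_approx.
Qed.

Hypothesis act : acts_by_homeomorphisms sigma.

Lemma continuous_translate s (h : X -> C) : continuous h ->
  continuous (fun x => h (sigma s x)).
Proof. by move=> ch x; apply: continuous_comp; [exact: act_continuous|exact: ch]. Qed.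

Lemma ell1_mul f g : ell1 f -> ell1 g -> ell1 (l1_mul sigma f g).
Proof.
move=> ef eg; have /ell1P[cf [M fM]] := ef; have /ell1P[cg [N gN]] := eg.
have M0 := l1le_ge0 fM; have N0 := l1le_ge0 gN.
apply/ell1P; split=> [s|].
  apply: continuous_unif => e e0.
  have [A HA] := @l1_mul_approx R G X sigma cX f g s e ef eg e0.
  exists (fun x => \sum_(t <- A) f t x * g (t^-1 * s)%g (sigma t^-1%g x)).
    by apply: continuous_sumC => t; apply: continuousMC => //; exact: continuous_translate.
  by move=> x; exact: HA.
exists (M * N) => A; apply/ler_addgt0Pr => e e0.
(* The error is shared among the coefficients in [A]; the successor covers the empty set. *)
pose d := e / (size A).+1%:R; have d0 : 0 < d by rewrite divr_gt0.
have [B HB] := l1_mul_approx_seq A id ef eg d0.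
apply: (@le_trans _ _ (\sum_(s <- A) (d + \sum_(t <- B) sup_norm (f t) * sup_norm (g (t^-1 * s)%g)))).
  rewrite !big_seq; apply: ler_sum => s sA; apply: sup_norm_le => [|x].
    by rewrite addr_ge0 ?(ltW d0)// sumr_ge0// => t _; rewrite mulr_ge0// sup_norm_ge0.
  have := HB s sA B (fsubset_refl _) x.
  set S := \sum_(t <- B) f t x * _ => hS.
  have := nrm_sub (l1_mul sigma f g s x) S 0; rewrite !subr0.
  have : nrm S <= \sum_(t <- B) sup_norm (f t) * sup_norm (g (t^-1 * s)%g).
    apply: le_trans (nrm_sum _ _ _) _; apply: ler_sum => t _; rewrite nrmM.
    by apply: ler_pM; rewrite ?nrm_ge0//; exact: nrm_le_supf.
  by move=> h1 h2; apply: le_trans h2 _; exact: lerD.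
rewrite big_split/= addrC lerD//; last first.
  rewrite big_const_seq count_predT iter_addr_0 -mulr_natr /d mulrAC ler_pdivrMr ?ltr0n//.
  by rewrite ler_wpM2l ?(ltW e0)// ler_nat.
rewrite exchange_big/=.
apply: (@le_trans _ _ (\sum_(t <- B) sup_norm (f t) * N)).
  apply: ler_sum => t _; rewrite -mulr_sumr ler_wpM2l ?sup_norm_ge0//.
  rewrite -(big_map (fun s => t^-1 * s)%g xpredT (fun s => sup_norm (g s))).
  by apply: sum_seq_l1 => //; rewrite map_inj_uniq ?fset_uniq//; exact: mulgI.
by rewrite -mulr_suml ler_wpM2r.
Qed.

Definition del (t : G) (h : X -> C) : G -> X -> C := fun s x => if s == t then h x else 0.

Lemma del_l1 t h : continuous h -> l1le (del t h) (sup_norm h).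
Proof.
move=> ch A.
have del_id : sup_norm (del t h t) = sup_norm h by rewrite /del eqxx.
have del0 s : s != t -> sup_norm (del t h s) = 0.
  move=> st; apply/eqP; rewrite eq_le sup_norm_ge0 andbT.
  by apply: sup_norm_le => // x; rewrite /del (negPf st) nrm0.
case: (boolP (t \in A)) => tA.
  by rewrite (bigD1_seq t) ?fset_uniq//= big1 ?addr0 ?del_id.
rewrite big1_seq ?sup_norm_ge0// => s /andP[_ sA]; apply: del0.
by apply: contraNneq tA => <-.
Qed.

Lemma ell1_del t h : continuous h -> ell1 (del t h).
Proof.
move=> ch; apply/ell1P; split; last by exists (sup_norm h); exact: del_l1.
move=> s; case: (eqVneq s t) => [->|st].
  by rewrite (_ : del t h t = h)// /del eqxx.
rewrite (_ : del t h s = cst 0); first exact: cst_continuous.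
by apply/funext => x; rewrite /del (negPf st).
Qed.

Lemma mul_del_l t h f s x : continuous h -> ell1 f ->
  l1_mul sigma (del t h) f s x = h x * f (t^-1 * s)%g (sigma t^-1%g x).
Proof.
move=> ch ef; rewrite (@l1_mul_single (del t h) f s t x (ell1_del t ch) ef).
  by rewrite /del eqxx.
by move=> t' tt'; rewrite /del (negPf tt') mul0r.
Qed.

Lemma mul_del_r t h f s x : continuous h -> ell1 f ->
  l1_mul sigma f (del t h) s x = f (s * t^-1)%g x * h (sigma (s * t^-1)^-1%g x).
Proof.
move=> ch ef.
rewrite (@l1_mul_single f (del t h) s (s * t^-1)%g x ef (ell1_del t ch)).
  by rewrite /del invgF mulgVK eqxx.
move=> t' tt'; rewrite /del; case: eqP => [e|]; last by rewrite mulr0.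
have es : s = (t' * t)%g by rewrite -e mulVKg.
by move: tt'; rewrite es mulgK eqxx.
Qed.

Lemma ell1_star f : ell1 f -> ell1 (l1_star sigma f).
Proof.
move=> /ell1P[cf [M fM]]; apply/ell1P; split=> [s|].
  by apply: (continuous_translate (h := fun x => (f s^-1%g x)^*)); exact: continuous_conj.
exists M => A.
apply: (@le_trans _ _ (\sum_(s <- A) sup_norm (f s^-1%g))).
  apply: ler_sum => s _; apply: sup_norm_le => [|x]; first exact: sup_norm_ge0.
  by rewrite /l1_star /translate nrm_conj nrm_le_sup.
rewrite -(big_map (fun s => s^-1)%g xpredT (fun s => sup_norm (f s))).
by apply: sum_seq_l1 => //; rewrite map_inj_uniq ?fset_uniq//; exact: invg_inj.
Qed.

End Ell1Algebra.

(** * Free actions *)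

Section FreeAction.
Variables (R : realType) (G : groupType) (X : topologicalType) (sigma : G -> X -> X).
Local Notation C := (Cplx R).
Hypothesis cX : compact [set: X].
Hypothesis hX : hausdorff_space X.
Hypothesis act : acts_by_homeomorphisms sigma.
Hypothesis free : free_action sigma.

(** Take disjoint neighbourhoods V of x and W of its image under t: a point whose image lies in W
    has its image outside V. *)
Lemma separating_nbhs x (l : seq G) : 1%g \notin l ->
  exists U : set X, [/\ open U, U x & forall t, t \in l -> forall y, U y -> ~ U (sigma t y)].
Proof.
elim: l => [|t l IH] l1; first by exists setT; split => //; exact: openT.
move: l1; rewrite inE negb_or => /andP[t1 /IH[U [oU Ux HU]]].
have tx : x != sigma t x.
  apply/eqP => e; apply: (free _ (esym e)) => t1'.
  by rewrite t1' eqxx in t1.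
have := hX; rewrite open_hausdorff => /(_ x (sigma t x) tx)[[V W] /= [xV tW] [oV oW /eqP VW]].
exists (U `&` V `&` (sigma t @^-1` W)); split.
- apply: openI; first exact: openI.
  by apply: open_comp => // y _; exact: act_continuous.
- by split; [split => //; exact: set_mem|exact: set_mem].
- move=> t'; rewrite inE => /predU1P[->|t'l] y [[Uy Vy] Wy].
    move=> [[_ Vty] _]; have : (V `&` W) (sigma t y) by split.
    by rewrite VW.
  by move=> [[Uty _] _]; exact: HU Uty.
Qed.

Lemma bump_function (U : set X) x : open U -> U x ->
  exists h : X -> R, [/\ continuous h, h x = 1 & forall y, ~ U y -> h y = 0].
Proof.
move=> oU Ux.
have cU : closed (~` U) by exact: open_closedC.
have cx : closed [set x].
  by apply: accessible_closed_set1; exact: hausdorff_accessible.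
have dis : ~` U `&` [set x] = set0.
  by apply/seteqP; split => // y [nU /= yx]; apply: nU; rewrite yx.
have /normal_separatorP := compact_normal hX cX.
move=> /(_ R _ _ cU cx dis)/(@uniform_separatorP X R)[h [ch h01 h0 h1]].
exists h; split=> //; first by apply: h1; exists x.
by move=> y nUy; apply: h0; exists y.
Qed.

(* Square roots of a partition of unity whose supports are moved off themselves by [l]. *)
Lemma free_partition (l : seq G) : 1%g \notin l ->
  exists phi : seq (X -> R), [/\ forall i, continuous (nth (fun=> 0) phi i),
    forall x, \sum_(h <- phi) h x ^+ 2 = 1 &
    forall i t x, t \in l -> nth (fun=> 0) phi i x * nth (fun=> 0) phi i (sigma t x) = 0].
Proof.
move=> l1.
have /choice[h Hh] : forall x, exists h : X -> R, [/\ continuous h, h x = 1 &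
    forall t y, t \in l -> h y * h (sigma t y) = 0].
  move=> x; have [U [oU Ux HU]] := separating_nbhs x l1.
  have [h [ch hx h0]] := bump_function oU Ux; exists h; split => // t y tl.
  have [Uy|nUy] := pselect (U y); last by rewrite h0 ?mul0r.
  by rewrite [h (sigma t y)]h0 ?mulr0//; exact: HU.
have FT : Filter (@totally X) by have PF := @totally_filter X; typeclasses eauto.
(* Compactness along the filter of finite sets of centres, directed by inclusion: one finite [D]
   serves all points. *)
have /compact_near_coveringP := cX.
move=> /(_ {fset X} totally (fun D y => exists2 x, x \in D & h x y != 0) FT)[].
  move=> x _; have [ch hx _] := Hh x.
  have hxx : h x x != 0 by rewrite hx oner_neq0.
  have nx : \forall y \near x, h x y != 0.
    have /cvgrPdist_lt/(_ 1 ltr01) := ch x.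
    apply: filterS => y; rewrite hx; apply: contraTN => /eqP->.
    by rewrite subr0 normr1 ltxx.
  exists ([set y | h x y != 0], [set D : {fset X} | (([fset x] `<=` D)%fset)]) => /=.
    by split => //; exists [fset x]%fset.
  by move=> [y D]/= [hy]; rewrite fsub1set => xD; exists x.
move=> D _ /(_ D (fsubset_refl D)) HD.
pose S y := \sum_(x <- D) h x y ^+ 2.
have S0 y : 0 < S y.
  have [x xD hy] := HD y I.
  rewrite /S (bigD1_seq x) ?fset_uniq//= ltr_pwDl//.
    by rewrite exprn_even_gt0.
  by apply: sumr_ge0 => i _; exact: sqr_ge0.
have cS : continuous (S : X -> R^o).
  rewrite /S; elim: (D : seq X) => [|x r IH].
    rewrite (_ : (fun y => _) = cst 0); first exact: cst_continuous.
    by apply/funext => y; rewrite big_nil.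
  rewrite (_ : (fun y => _) = (fun y => h x y * h x y + \sum_(i <- r) h i y ^+ 2)).
    have [ch _ _] := Hh x.
    by move=> y; apply: cvgD; [apply: cvgM; exact: ch|exact: IH].
  by apply/funext => y; rewrite big_cons expr2.
exists [seq (fun y => h x y / Num.sqrt (S y)) | x <- D]; split.
- move=> i; case: (ltnP i (size D)) => iD; last first.
    by rewrite nth_default ?size_map//; exact: cst_continuous.
  have x0 : X by case: (D : seq X) iD.
  rewrite (nth_map x0)// => y; have [ch _ _] := Hh (nth x0 D i).
  apply: cvgM; first exact: ch.
  apply: cvgV; first by rewrite sqrtr_eq0 -ltNge.
  by apply: (@continuous_comp _ _ _ S (@Num.sqrt R)); [exact: cS|exact: sqrt_continuous].
- move=> y; rewrite big_map.
  under eq_bigr do rewrite expr_div_n sqr_sqrtr ?ltW//.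
  by rewrite -mulr_suml -/(S y) divff//; exact: lt0r_neq0 (S0 y).
- move=> i t y tl; case: (ltnP i (size D)) => iD; last first.
    by rewrite nth_default ?size_map// mul0r.
  have x0 : X by case: (D : seq X) iD.
  rewrite (nth_map x0)//; have [_ _ hh] := Hh (nth x0 D i).
  by rewrite mulrACA hh// mul0r.
Qed.

Section Ideal.
Variable J : set (G -> X -> C).
Hypothesis idJ : ideal sigma J.
Hypothesis clJ : l1_closed J.

Lemma closed_mem f : ell1 f ->
  (forall e : R, 0 < e -> exists2 g, J g & l1le (fun s x => f s x - g s x) e) -> J f.
Proof.
move=> ef H; apply: clJ => // e e0; have [g Jg fg] := H (e / 2) (divr_gt0 e0 (ltr0n _ 2)).
exists g => //; have /l1_normP h := fg.
by apply: le_lt_trans h _; rewrite lte_fin; lra.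
Qed.

Lemma ideal_sum (T : Type) (r : seq T) (F : T -> G -> X -> C) :
  (forall i, J (F i)) -> J (fun s x => \sum_(i <- r) F i s x).
Proof.
move=> JF; elim: r => [|i r IH].
  rewrite (_ : (fun s x => _) = (fun _ _ => 0)); first exact: ideal_0 idJ.
  by apply/funext => s; apply/funext => x; rewrite big_nil.
rewrite (_ : (fun s x => _) = (fun s x => F i s x + \sum_(j <- r) F j s x)).
  exact: (ideal_D idJ (JF i) IH).
by apply/funext => s; apply/funext => x; rewrite big_cons.
Qed.

Lemma expectation_mem a : J a -> J (del 1%g (a 1%g)).
Proof.
move=> Ja; have ea := ideal_sub idJ Ja; have /ell1P[ca [M aM]] := ea.
apply: closed_mem (ell1_del 1%g (ca 1%g)) _ => e e0; have [A HA] := l1_tail aM e0.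
(* Inverses occur because the coefficient at s of phi a phi evaluates the second phi at
   [sigma s^-1 x]. *)
pose l := [seq s^-1%g | s <- A & s != 1%g].
have l1 : 1%g \notin l.
  by apply/negP => /mapP[s]; rewrite mem_filter => /andP[s1 _] /esym/eqP; rewrite invg_eq1 (negPf s1).
have [phi [cphi phi1 phi0]] := free_partition l1.
pose ph i x : C := (nth (fun=> 0) phi i x)%:C%C.
have cph i : continuous (ph i) by apply: continuous_ofreal; exact: cphi.
pose n := size phi.
pose b s x := \sum_(i <- iota 0 n) (ph i x * a s x * ph i (sigma s^-1%g x)).
(* By |pq| <= (p^2 + q^2)/2, the compression does not enlarge the coefficients outside [A], where
   nothing else is known of it. *)
have phsum (x y : X) : \sum_(i <- iota 0 n) nrm (ph i x * ph i y) <= 1.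
  have sq z : \sum_(i <- iota 0 n) nth (fun=> 0) phi i z ^+ 2 = 1.
    rewrite -(phi1 z) (big_nth (fun=> 0)) /index_iota subn0//.
  rewrite -[leRHS]/(1 : R).
  apply: (@le_trans _ _ (\sum_(i <- iota 0 n) (nth (fun=> 0) phi i x ^+ 2 + nth (fun=> 0) phi i y ^+ 2) / 2)).
    apply: ler_sum => i _; rewrite /ph -rmorphM/= nrm_real.
    set p := nth _ _ _ x; set q := nth _ _ _ y.
    have := sqr_ge0 (p - q); have := sqr_ge0 (p + q).
    by rewrite ler_norml => h1 h2; apply/andP; split; nra.
  by rewrite -mulr_suml big_split/= !sq; lra.
exists b.
  apply: (@ideal_sum nat _ (fun i s x => ph i x * a s x * ph i (sigma s^-1%g x))) => i.
  have J1 : J (l1_mul sigma (del 1%g (ph i)) a) by exact: (ideal_Ml idJ (ell1_del 1%g (cph i)) Ja).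
  have e1 := ideal_sub idJ J1.
  have := ideal_Mr idJ J1 (ell1_del 1%g (cph i)).
  congr J; apply/funext => s; apply/funext => x.
  rewrite (@mul_del_r R G X sigma cX 1%g (ph i) _ s x (cph i) e1) invg1 mulg1.
  by rewrite (@mul_del_l R G X sigma cX 1%g (ph i) a s x (cph i) ea) invg1 mul1g (act_1 act).
move=> B.
have key s : sup_norm (fun x => del 1%g (a 1%g) s x - b s x) <=
    if (s \notin A) && (s != 1%g) then sup_norm (a s) else 0.
  apply: sup_norm_le => [|x]; first by case: ifP => // _; exact: sup_norm_ge0.
  rewrite /del /b; case: eqP => [->|/eqP s1].
    rewrite andbF (_ : _ - _ = 0) ?nrm0//; apply/eqP; rewrite subr_eq0; apply/eqP.
    rewrite invg1 (act_1 act).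
    rewrite -[LHS]mul1r (_ : 1 = \sum_(i <- iota 0 n) ph i x * ph i x).
      by rewrite mulr_suml; apply: eq_bigr => i _; ring.
    rewrite -[LHS](rmorph1 (@real_complex R)) -(phi1 x) rmorph_sum/= (big_nth (fun=> 0)).
    by rewrite /index_iota subn0; apply: eq_bigr => i _; rewrite expr2 rmorphM.
  case: (boolP (s \in A)) => sA /=.
    rewrite big1_seq ?subrr ?nrm0// => i _.
    rewrite mulrAC /ph -rmorphM/= phi0 ?mul0r//.
    by apply/mapP; exists s => //; rewrite mem_filter s1.
  rewrite sub0r nrmN; apply: le_trans (nrm_sum _ _ _) _.
  apply: (@le_trans _ _ (\sum_(i <- iota 0 n) sup_norm (a s) * nrm (ph i x * ph i (sigma s^-1%g x)))).
    apply: ler_sum => i _.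
    rewrite (_ : _ * _ = a s x * (ph i x * ph i (sigma s^-1%g x))); last by ring.
    rewrite (nrmM (a s x)).
    by apply: ler_wpM2r; [exact: nrm_ge0|exact: nrm_le_sup].
  by rewrite -mulr_sumr ler_piMr ?sup_norm_ge0.
apply: le_trans (ler_sum _ (fun s _ => key s)) _.
rewrite -big_mkcond -big_filter; apply: HA; first by rewrite filter_uniq ?fset_uniq.
by move=> t; rewrite mem_filter => /andP[/andP[]].
Qed.

(** Right multiplication by [del s^-1 1] moves the coefficient at s to the identity, where
    [expectation_mem] applies. *)
Lemma coefficient_mem f s : J f -> J (del 1%g (f s)).
Proof.
move=> Jf; have ef := ideal_sub idJ Jf.
have c1 : continuous (cst 1 : X -> C) by exact: cst_continuous.
have := expectation_mem (ideal_Mr idJ Jf (ell1_del s^-1%g c1)).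
by congr J; congr del; apply/funext => x;
  rewrite (@mul_del_r R G X sigma cX _ _ f _ x c1 ef) invgK mul1g mulr1.
Qed.

Lemma conj_mem (h : X -> C) : continuous h -> J (del 1%g h) ->
  J (del 1%g (fun x => (h x)^*)).
Proof.
move=> ch Jh; have cc := continuous_conj ch.
apply: closed_mem (ell1_del 1%g cc) _ => e e0.
pose w x : R := (nrm (h x) ^+ 2 + e ^+ 2)^-1.
have w0 x : 0 < nrm (h x) ^+ 2 + e ^+ 2 by rewrite ltr_wpDl ?sqr_ge0// exprn_gt0.
have cw : continuous w.
  move=> x; apply: cvgV; first by rewrite lt0r_neq0.
  apply: cvgD; last exact: cvg_cst.
  rewrite /w; under eq_cvg do rewrite expr2; rewrite expr2.
  by apply: cvgM; exact: continuous_nrm.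
pose k x : C := (h x)^* * (h x)^* * (w x)%:C%C.
have ck : continuous k.
  by apply: continuousMC; [apply: continuousMC|exact: continuous_ofreal].
exists (l1_mul sigma (del 1%g k) (del 1%g h)).
  exact: (ideal_Ml idJ (ell1_del 1%g ck) Jh).
have cd : continuous (fun x => (h x)^* - k x * h x : C).
  by move=> x; apply: cvgB; [exact: cc|apply: cvgM; [exact: ck|exact: ch]].
rewrite (_ : (fun s x => _) = del 1%g (fun x => (h x)^* - k x * h x)).
  move=> A; apply: le_trans (del_l1 1%g cd A) _.
  apply: sup_norm_le => [|x]; first exact: ltW.
  have -> : (h x)^* - k x * h x = (h x)^* * (1 - nrm (h x) ^+ 2 * w x)%:C%C.
    rewrite rmorphB rmorphM/= rmorph1 -conj_mul /k; ring.
  rewrite nrmM nrm_conj nrm_real.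
  have -> : 1 - nrm (h x) ^+ 2 * w x = e ^+ 2 * w x.
    apply: (mulIf (lt0r_neq0 (w0 x))); rewrite mulrBl mul1r -!mulrA mulVf ?lt0r_neq0//.
    by rewrite !mulr1 addrAC subrr add0r.
  rewrite ger0_norm; last by rewrite mulr_ge0 ?sqr_ge0// invr_ge0 ltW.
  rewrite /w mulrA ler_pdivrMr//.
  (* The error is p e^2 / (p^2 + e^2), which is at most e since p e <= p^2 + e^2. *)
  have := nrm_ge0 (h x); set p := nrm (h x) => p0.
  have := sqr_ge0 (p - e); nra.
apply/funext => s; apply/funext => x.
rewrite (@mul_del_l R G X sigma cX 1%g k _ s x ck (ell1_del 1%g ch)).
rewrite invg1 mul1g (act_1 act) /del; case: eqP => // _.
by rewrite mulr0 subrr.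
Qed.

Lemma closed_ideal_self_adjoint : self_adjoint sigma J.
Proof.
move=> f Jf; have ef := ideal_sub idJ Jf.
have es := ell1_star cX act ef; have /ell1P[cs [M sM]] := es.
have /ell1P[cf _] := ef.
have c1 : continuous (cst 1 : X -> C) by exact: cst_continuous.
(* Left multiplication by [del s 1] translates by s the conjugate of the coefficient at s^-1, which
   is the coefficient of the adjoint. *)
have mem s : J (del s (l1_star sigma f s)).
  have cc := continuous_conj (cf s^-1%g).
  have := ideal_Ml idJ (ell1_del s c1) (conj_mem (cf s^-1%g) (coefficient_mem s^-1%g Jf)).
  congr J; apply/funext => t; apply/funext => x.
  rewrite (@mul_del_l R G X sigma cX s _ _ t x c1 (ell1_del 1%g cc)).
  rewrite mul1r /del; case: (eqVneq t s) => [->|ts]; first by rewrite mulVg eqxx.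
  rewrite ifF//; apply/negbTE; apply: contraNneq ts => e.
  by rewrite -(mulVKg s t) e mulg1.
apply: closed_mem => // e e0; have [A HA] := l1_tail sM e0.
exists (fun t x => \sum_(s <- A) del s (l1_star sigma f s) t x).
  exact: ideal_sum.
move=> B.
have key t : sup_norm (fun x => l1_star sigma f t x - \sum_(s <- A) del s (l1_star sigma f s) t x) <=
    if t \notin A then sup_norm (l1_star sigma f t) else 0.
  apply: sup_norm_le => [|x]; first by case: ifP => // _; exact: sup_norm_ge0.
  case: (boolP (t \in A)) => tA /=.
    rewrite (bigD1_seq t) ?fset_uniq//= big1 ?addr0; last first.
      by move=> s st; rewrite /del eq_sym (negPf st).
    by rewrite /del eqxx subrr nrm0.
  rewrite big1_seq ?subr0; first exact: (nrm_le_sup cX x (cs t)).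
  move=> s /andP[_ sA]; rewrite /del; case: eqP => // ts.
  by move: tA; rewrite ts sA.
apply: le_trans (ler_sum _ (fun s _ => key s)) _.
rewrite -big_mkcond -big_filter; apply: HA; first by rewrite filter_uniq ?fset_uniq.
by move=> t; rewrite mem_filter => /andP[].
Qed.

End Ideal.
End FreeAction.

(** * Actions that are not free *)

Section IntegerPowers.
Variable G : groupType.
Implicit Types (s t r : G) (m n : int).

Definition zexp s n : G := if n is Negz k then (s^-1 ^+ k.+1)%g else (s ^+ absz n)%g.

Lemma zexpS s n : zexp s (n + 1) = (zexp s n * s)%g.
Proof.
case: n => [n|[|n]].
- by rewrite -PoszD addn1 /zexp/= expgSr.
- by rewrite (_ : Negz 0 + 1 = 0)// /zexp expg0 expg1 mulVg.
- have -> : Negz n.+1 + 1 = Negz n by lia.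
  by rewrite /zexp [in RHS]expgSr mulgVK.
Qed.

Lemma zexpD s n (i : nat) : zexp s (n + i%:Z) = (zexp s n * s ^+ i)%g.
Proof.
elim: i => [|i IH]; first by rewrite addr0 expg0 mulg1.
by rewrite -addn1 PoszD addrA zexpS IH -mulgA addn1 -expgSr.
Qed.

Lemma zexp_inj s : torsion_free G -> s <> 1%g -> injective (zexp s).
Proof.
move=> tf s1; suff H n (i : nat) : zexp s (n + i%:Z) = zexp s n -> i = 0%N.
  move=> m n; wlog mn : m n / m <= n => [W|].
    by case/orP: (le_total m n) => /W // h /esym/h.
  move=> e; have := H m `|n - m|%N; rewrite gez0_abs ?subr_ge0//.
  rewrite addrCA subrr addr0 => /(_ (esym e)) h.
  by apply/esym/eqP; rewrite -subr_eq0 -absz_eq0 h.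
rewrite zexpD -[RHS]mulg1 => /mulgI si; apply/eqP; rewrite -leqn0 leqNgt; apply/negP => i0.
exact/s1/(tf s i).
Qed.

Lemma zexpN s n : zexp s (- n) = (zexp s n)^-1%g.
Proof.
have H (k : nat) : (s^-1 ^+ k * s ^+ k = 1)%g.
  elim: k => [|k IH]; first by rewrite !expg0 mulg1.
  by rewrite expgSr expgS mulgA mulgVK.
have inv (x y : G) : (x * y = 1)%g -> x = (y^-1)%g.
  by move=> xy; apply: (mulIg y); rewrite xy mulVg.
case: n => [[|n]|n].
- by rewrite oppr0 /zexp/= expg0 invg1.
- by rewrite -NegzE /zexp/=; exact/inv/H.
- by rewrite NegzE opprK /zexp/= -[LHS]invgK; congr (_^-1)%g; apply/esym/inv/H.
Qed.

End IntegerPowers.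

(** * The closed ideal attached to a fixed point *)

Section NonFreeAction.
Variables (R : realType) (G : groupType) (X : topologicalType) (sigma : G -> X -> X).
Local Notation C := (Cplx R).
Hypothesis cX : compact [set: X].
Hypothesis act : acts_by_homeomorphisms sigma.
Hypothesis abG : abelian_group G.
Variables (s : G) (x0 : X).
Hypothesis fix_s : sigma s x0 = x0.
Implicit Types (a b : G -> X -> C) (r t : G) (y : X).

Let mulgC (u v : G) : (u * v = v * u)%g := abG u v.

(** Since s commutes with t, it fixes the whole orbit of x0 along with x0. *)
Lemma fix_orbit t (i : nat) : sigma (s ^+ i)%g (sigma t x0) = sigma t x0.
Proof.
elim: i => [|i IH]; first by rewrite expg0 (act_1 act).
rewrite expgSr (act_M act) -(act_M act s t) mulgC (act_M act) fix_s.
exact: IH.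
Qed.

Lemma fix_orbitV t (i : nat) : sigma ((s ^+ i)^-1)%g (sigma t x0) = sigma t x0.
Proof. by rewrite -{1}(fix_orbit t i) -(act_M act) mulVg (act_1 act). Qed.

Variables (L : nat -> nat) (T : nat -> int -> C) (K : R).
Hypothesis TK : forall J n, nrm (T J n) <= K.
Hypothesis s_inf : injective (fun i : nat => s ^+ i)%g.

(** The window from -L to L is shifted to natural exponents; as r runs over the whole group, it
    absorbs the missing power s^-L. *)
Definition pair J a r y : C :=
  \sum_(i < (2 * L J).+1) T J (i%:Z - (L J)%:Z) * a (r * s ^+ i)%g y.

Definition annihilator : set (G -> X -> C) := fun a => ell1 a /\
  forall e : R, 0 < e -> exists J0, forall J, (J0 <= J)%N ->
    forall r t, nrm (pair J a r (sigma t x0)) <= e.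

Lemma K_ge0 : 0 <= K.
Proof. exact: le_trans (nrm_ge0 _) (TK 0%N 0). Qed.

Lemma pair_lin J (c : C) a b r y :
  pair J (fun u x => a u x + c * b u x) r y = pair J a r y + c * pair J b r y.
Proof. by rewrite /pair mulr_sumr -big_split/=; apply: eq_bigr => i _; ring. Qed.

Lemma pair_le J a M r y : ell1 a -> l1le a M -> nrm (pair J a r y) <= K * M.
Proof.
move=> ea aM; apply: le_trans (nrm_sum _ _ _) _.
apply: (@le_trans _ _ (\sum_(i < (2 * L J).+1) K * sup_norm (a (r * s ^+ i)%g))).
  apply: ler_sum => i _; rewrite nrmM; apply: ler_pM; rewrite ?nrm_ge0//.
  exact: nrm_le_supf.
rewrite -mulr_sumr ler_wpM2l ?K_ge0//.
rewrite -(big_mkord xpredT (fun i => sup_norm (a (r * s ^+ i)%g))).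
rewrite -(big_map (fun i => r * s ^+ i)%g xpredT (fun u => sup_norm (a u))).
apply: sum_seq_l1 => //; rewrite map_inj_uniq ?iota_uniq// => i j /mulgI.
exact: s_inf.
Qed.

(* The index sets B i may depend on i: [pair_mulr] needs the set of the
   t^-1 * (r * s ^+ i) to be the same for all i. *)
Lemma pair_approx J a b r y (M : R) : ell1 a -> ell1 b ->
  (forall A : {fset G}, exists B : 'I_(2 * L J).+1 -> {fset G}, (forall i, (A `<=` B i)%fset) /\
    nrm (\sum_(i < (2 * L J).+1) T J (i%:Z - (L J)%:Z) *
      \sum_(t <- B i) a t y * b (t^-1 * (r * s ^+ i))%g (sigma t^-1%g y)) <= M) ->
  nrm (pair J (l1_mul sigma a b) r y) <= M.
Proof.
move=> ea eb H; apply/ler_addgt0Pr => e e0.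
pose N := (2 * L J).+1.
have d0 : 0 < e / (K + 1) / N%:R by rewrite !divr_gt0// ltr_wpDl// K_ge0.
have [A HA] := @l1_mul_approx_seq R G X sigma cX _ (enum 'I_N)
  (fun i : 'I_N => r * s ^+ i)%g a b _ ea eb d0.
have [B [AB hB]] := H A.
set S := \sum_(i < _) _ in hB.
have := nrm_sub (pair J (l1_mul sigma a b) r y) S 0; rewrite !subr0.
move/le_trans; apply; rewrite addrC; apply: lerD => //.
rewrite /pair /S -sumrB; apply: le_trans (nrm_sum _ _ _) _.
apply: (@le_trans _ _ (\sum_(i < N) K * (e / (K + 1) / N%:R))).
  apply: ler_sum => i _; rewrite -mulrBr nrmM; apply: ler_pM; rewrite ?nrm_ge0//.
  by apply: HA; rewrite ?mem_enum.
have K1 : 0 < K + 1 by rewrite ltr_wpDl// K_ge0.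
rewrite sumr_const card_ord -(mulr_natr (K * _)) -(mulrA K) divfK ?pnatr_eq0//.
rewrite mulrCA -[leRHS]mulr1 ler_wpM2l ?(ltW e0)// ler_pdivrMr// mul1r.
by rewrite lerDl.
Qed.

(** The term of a at u pairs b at the translates u^-1 r and u^-1 t; this is why the annihilation is
    required uniformly in r and t. *)
Lemma pair_mull J a b M r t (e : R) : ell1 a -> ell1 b -> l1le a M ->
  (forall r t, nrm (pair J b r (sigma t x0)) <= e) ->
  nrm (pair J (l1_mul sigma a b) r (sigma t x0)) <= M * e.
Proof.
move=> ea eb aM H.
have e0 : 0 <= e by apply: le_trans (H 1%g 1%g); exact: nrm_ge0.
apply: pair_approx => // A; exists (fun=> A); split=> //.
under eq_bigr do rewrite mulr_sumr.
rewrite exchange_big/=.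
apply: (@le_trans _ _ (\sum_(u <- A) sup_norm (a u) * e)); last first.
  by rewrite -mulr_suml ler_wpM2r.
apply: le_trans (nrm_sum _ _ _) _; apply: ler_sum => u _.
rewrite (_ : \sum_(i < _) _ = a u (sigma t x0) * pair J b (u^-1 * r)%g (sigma (u^-1 * t)%g x0)).
  rewrite nrmM; apply: ler_pM; rewrite ?nrm_ge0//; exact: nrm_le_supf.
rewrite /pair mulr_sumr; apply: eq_bigr => i _.
by rewrite (act_M act) mulgA mulrCA.
Qed.

(** The sums are reindexed by the argument p of b. Then a is taken at r p^-1 s^i by commutativity,
    and b is evaluated at a point that does not depend on i because s fixes the orbit: b p factors
    out of a pairing of a. *)
Lemma pair_mulr J a b M r t (e : R) : ell1 a -> ell1 b -> l1le b M ->
  (forall r t, nrm (pair J a r (sigma t x0)) <= e) ->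
  nrm (pair J (l1_mul sigma a b) r (sigma t x0)) <= M * e.
Proof.
move=> ea eb bM H.
have e0 : 0 <= e by apply: le_trans (H 1%g 1%g); exact: nrm_ge0.
pose N := (2 * L J).+1.
apply: pair_approx => // A.
pose P := [fset (u.1^-1 * (r * s ^+ (nat_of_ord u.2)))%g | u in
  [seq (v, i) | v <- A, i <- enum 'I_N]]%fset.
pose B (i : 'I_N) := [fset (r * s ^+ (nat_of_ord i) * p^-1)%g | p in P]%fset.
exists B; split=> [i|].
  apply/fsubsetP => v vA; apply/imfsetP; exists (v^-1 * (r * s ^+ i))%g => /=.
    apply/imfsetP; exists (v, i) => //=; apply/allpairsP; exists (v, i) => /=.
    by rewrite mem_enum.
  by apply: (mulIg (v^-1 * (r * s ^+ i))%g); rewrite mulgVK mulVKg.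
have sumB (i : 'I_N) (F : G -> C) :
    \sum_(v <- B i) F v = \sum_(p <- P) F (r * s ^+ (nat_of_ord i) * p^-1)%g.
  rewrite -(big_map (fun p => r * s ^+ (nat_of_ord i) * p^-1)%g xpredT F).
  apply: perm_big; apply: uniq_perm; first exact: fset_uniq.
    by rewrite map_inj_uniq ?fset_uniq// => p q /mulgI/invg_inj.
  move=> v; apply/idP/idP => [/imfsetP[p /= pP ->]|/mapP[p pP ->]].
    by apply: map_f.
  by apply/imfsetP; exists p.
under eq_bigr do rewrite sumB mulr_sumr.
rewrite exchange_big/=.
apply: (@le_trans _ _ (\sum_(p <- P) sup_norm (b p) * e)); last first.
  by rewrite -mulr_suml ler_wpM2r.
apply: le_trans (nrm_sum _ _ _) _; apply: ler_sum => p _.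
rewrite (_ : \sum_(i < _) _ = b p (sigma (p * r^-1 * t)%g x0) * pair J a (r * p^-1)%g (sigma t x0)).
  rewrite nrmM; apply: ler_pM; rewrite ?nrm_ge0//; exact: nrm_le_supf.
rewrite /pair mulr_sumr; apply: eq_bigr => i _.
have -> : (r * s ^+ i * p^-1 = r * p^-1 * s ^+ i)%g by rewrite -!mulgA (mulgC (s ^+ i)%g).
rewrite [RHS]mulrC -mulrA; congr (_ * (_ * _)).
have -> : ((r * p^-1 * s ^+ i)^-1 * (r * s ^+ i) = p)%g.
  rewrite (mulgC r p^-1%g) -(mulgA p^-1%g).
  have -> : ((p^-1 * (r * s ^+ i))^-1 = (r * s ^+ i)^-1 * p)%g.
    by apply: (mulIg (p^-1 * (r * s ^+ i))%g); rewrite mulVg mulgA mulgK mulVg.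
  by rewrite (mulgC _ p) mulgVK.
have -> : ((r * p^-1 * s ^+ i)^-1 = p * r^-1 * (s ^+ i)^-1)%g.
  apply: (mulIg (r * p^-1 * s ^+ i)%g); rewrite mulVg.
  rewrite (mulgC (r * p^-1)%g) mulgA mulgVK mulgA mulgVK mulgV//.
by rewrite (act_M act) fix_orbitV (act_M act _ t).
Qed.

Lemma annihilator_ideal : ideal sigma annihilator.
Proof.
have lin a b (c : C) : annihilator a -> annihilator b ->
    ell1 (fun u x => a u x + c * b u x) -> annihilator (fun u x => a u x + c * b u x).
  move=> [_ Ha] [_ Hb] eab; split => // e e0.
  have c0 := nrm_ge0 c; have c1 : 0 < nrm c + 1 by lra.
  have [J1 H1] := Ha _ (divr_gt0 e0 (ltr0n _ 2)).
  have [J2 H2] := Hb _ (divr_gt0 (divr_gt0 e0 (ltr0n _ 2)) c1).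
  exists (maxn J1 J2) => J; rewrite geq_max => /andP[/H1 {}H1 /H2 {}H2] r t.
  rewrite pair_lin; apply: le_trans (nrmD _ _) _; rewrite nrmM.
  have h1 := H1 r t; have := ler_wpM2l c0 (H2 r t).
  have : nrm c * (e / 2 / (nrm c + 1)) <= e / 2.
    rewrite mulrCA -[leRHS]mulr1 ler_wpM2l ?divr_ge0 ?(ltW e0)//.
    by rewrite ler_pdivrMr// mul1r lerDl.
  move=> h2 h3; have h4 := le_trans h3 h2.
  by apply: le_trans (lerD h1 h4) _; lra.
have l1lin a b (c : C) : ell1 a -> ell1 b -> ell1 (fun u x => a u x + c * b u x).
  move=> /ell1P[ca [M aM]] /ell1P[cb [N bN]]; apply/ell1P; split=> [u|].
    apply: continuousDC => //; apply: (continuousMC (h := cst c)) => //.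
    exact: cst_continuous.
  exists (M + nrm c * N) => A.
  apply: (@le_trans _ _ (\sum_(u <- A) (sup_norm (a u) + nrm c * sup_norm (b u)))).
    apply: ler_sum => u _; apply: sup_norm_le => [|x].
      by rewrite addr_ge0 ?mulr_ge0 ?nrm_ge0 ?sup_norm_ge0.
    apply: le_trans (nrmD _ _) _; rewrite nrmM lerD ?ler_wpM2l ?nrm_ge0//;
      exact: nrm_le_sup.
  by rewrite big_split/= -mulr_sumr lerD// ler_wpM2l// nrm_ge0.
have ell10 : ell1 (fun (_ : G) (_ : X) => 0 : C).
  apply/ell1P; split=> [u|]; first exact: cst_continuous.
  exists 0 => A; rewrite big1// => u _; apply/eqP; rewrite eq_le sup_norm_ge0 andbT.
  by apply: sup_norm_le => // x; rewrite nrm0.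
have ann0 : annihilator (fun (_ : G) (_ : X) => 0 : C).
  split=> // e e0; exists 0%N => J _ r t.
  by rewrite /pair big1 ?nrm0 ?(ltW e0)// => i _; rewrite mulr0.
split.
- by move=> a [].
- exact: ann0.
- move=> a b Ia Ib.
  have -> : (fun u x => a u x + b u x) = (fun u x => a u x + 1 * b u x).
    by apply/funext => u; apply/funext => x; rewrite mul1r.
  by apply: lin => //; apply: l1lin; [case: Ia|case: Ib].
- move=> c a Ia.
  have -> : (fun u x => c * a u x) = (fun u x => (fun (_ : G) (_ : X) => 0 : C) u x + c * a u x).
    by apply/funext => u; apply/funext => x; rewrite add0r.
  by apply: lin => //; apply: l1lin => //; case: Ia.
- move=> a b ea [eb Hb]; split; first exact: ell1_mul.
  move=> e e0; have /ell1P[_ [M aM]] := ea; have M0 := l1le_ge0 aM.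
  have M1 : 0 < M + 1 by lra.
  have [J0 HJ] := Hb _ (divr_gt0 e0 M1); exists J0 => J /HJ {}HJ r t.
  apply: le_trans (pair_mull r t ea eb aM HJ) _.
  rewrite mulrCA -[leRHS]mulr1 ler_wpM2l ?(ltW e0)//.
  by rewrite ler_pdivrMr// mul1r lerDl.
- move=> a b [ea Ha] eb; split; first exact: ell1_mul.
  move=> e e0; have /ell1P[_ [M bM]] := eb; have M0 := l1le_ge0 bM.
  have M1 : 0 < M + 1 by lra.
  have [J0 HJ] := Ha _ (divr_gt0 e0 M1); exists J0 => J /HJ {}HJ r t.
  apply: le_trans (pair_mulr r t ea eb bM HJ) _.
  rewrite mulrCA -[leRHS]mulr1 ler_wpM2l ?(ltW e0)//.
  by rewrite ler_pdivrMr// mul1r lerDl.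
Qed.

Lemma annihilator_closed : l1_closed annihilator.
Proof.
move=> f ef H; split => // e e0.
have K1 : 0 < K + 1 by have := K_ge0; lra.
have [g [eg Hg] fg] := H _ (divr_gt0 (divr_gt0 e0 (ltr0n _ 2)) K1).
have [J0 HJ] := Hg _ (divr_gt0 e0 (ltr0n _ 2)); exists J0 => J /HJ {}HJ r t.
have fgM : l1le (fun u x => f u x - g u x) (e / 2 / (K + 1)) by apply/l1_normP; exact: ltW.
have efg : ell1 (fun u x => f u x - g u x).
  have [cf _] := ef; have [cg _] := eg.
  apply/ell1P; split; last by exists (e / 2 / (K + 1)).
  by move=> u x; apply: cvgB; [exact: cf|exact: cg].
have := pair_le J r (sigma t x0) efg fgM.
have -> : pair J (fun u x => f u x - g u x) r (sigma t x0) =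
    pair J f r (sigma t x0) - pair J g r (sigma t x0).
  by rewrite /pair -sumrB; apply: eq_bigr => i _; rewrite mulrBr.
have h : K * (e / 2 / (K + 1)) <= e / 2.
  rewrite mulrCA -[leRHS]mulr1 ler_wpM2l ?divr_ge0 ?(ltW e0)//.
  by rewrite ler_pdivrMr// mul1r lerDl.
move=> /le_trans/(_ h) h1; have h2 := HJ r t.
have := nrm_sub (pair J f r (sigma t x0)) (pair J g r (sigma t x0)) 0; rewrite !subr0.
by move=> /le_trans; apply; apply: le_trans (lerD h1 h2) _; lra.
Qed.

End NonFreeAction.

Section Witness.
Variables (R : realType) (G : groupType) (X : topologicalType).
Local Notation C := (Cplx R).
Variable s : G.
Hypothesis s_inj : injective (zexp s).
Implicit Types (z : int -> C) (n : int).

Definition zindex (g : G) : int := xget 0 [set n | zexp s n = g].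

Lemma zexpK : cancel (zexp s) zindex.
Proof.
by move=> n; apply: s_inj; exact: (xgetPex 0 (ex_intro (fun m => zexp s m = zexp s n) n erefl)).
Qed.

(** The test discards the elements that are not powers of s, on which [zindex] has the default value
    0. *)
Definition zfun z : G -> X -> C :=
  fun g _ => if zexp s (zindex g) == g then z (zindex g) else 0.

Lemma zfunE z n x : zfun z (zexp s n) x = z n.
Proof. by rewrite /zfun zexpK eqxx. Qed.

Lemma sum_le_zsum (F : int -> R) (l : seq int) N : (forall n, 0 <= F n) -> uniq l ->
  {in l, forall n, (`|n| <= N)%N} -> \sum_(n <- l) F n <= zsum N F.
Proof.
move=> F0 ul lN; rewrite /zsum -(big_mkord xpredT (fun i => F (i%:Z - N%:Z))).
rewrite -(big_map (fun i : nat => i%:Z - N%:Z) xpredT F) [leRHS](bigID (mem l)).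
rewrite -[leLHS]addr0 lerD ?sumr_ge0//.
rewrite le_eqVlt; apply/orP; left; apply/eqP; rewrite -[RHS]big_filter.
apply: perm_big; apply: uniq_perm => //.
  rewrite filter_uniq// map_inj_uniq ?iota_uniq// => i j /addIr; by case.
move=> n; rewrite mem_filter; apply/idP/andP => [nl|[]//]; split=> //.
have := lN n nl => nN; apply/mapP; exists `|(n + N%:Z)%R|%N; last by lia.
by rewrite mem_index_iota; lia.
Qed.

Lemma ell1_zfun z A : (forall N, zsum N (fun n => nrm (z n)) <= A) -> ell1 (zfun z).
Proof.
move=> zA; apply/ell1P; split=> [g|]; first exact: cst_continuous.
exists A => B.
have zle g : sup_norm (zfun z g) <= if zexp s (zindex g) == g then nrm (z (zindex g)) else 0.
  apply: sup_norm_le => [|x]; rewrite /zfun; case: ifP => // _; first exact: nrm_ge0.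
  by rewrite nrm0.
apply: le_trans (ler_sum _ (fun g _ => zle g)) _.
rewrite -big_mkcond -big_filter -(big_map zindex xpredT (fun n => nrm (z n))).
set l := map _ _; apply: le_trans (zA (\max_(n <- l) `|n|)%N).
apply: sum_le_zsum => [n||n nl]; first exact: nrm_ge0.
  rewrite map_inj_in_uniq ?filter_uniq ?fset_uniq// => g h.
  by rewrite !mem_filter => /andP[/eqP gE _] /andP[/eqP hE _] gh; rewrite -gE gh.
exact: leq_bigmax_seq.
Qed.

Variables (L : nat -> nat) (T : nat -> int -> C).

Lemma pair_zfun z J k y : pair s L T J (zfun z) (zexp s k) y =
  \sum_(i < (2 * L J).+1) T J (i%:Z - (L J)%:Z) * z (i%:Z - (L J)%:Z + (k + (L J)%:Z)).
Proof.
rewrite /pair; apply: eq_bigr => i _; rewrite -zexpD zfunE; congr (_ * z _).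
by rewrite addrACA addNr addr0 addrC.
Qed.

Lemma pair_zfun0 z J r y : (forall k, r <> zexp s k) -> pair s L T J (zfun z) r y = 0.
Proof.
move=> rk; rewrite /pair big1// => i _; rewrite /zfun; case: eqP; last by rewrite mulr0.
set n := zindex _ => e; case: (rk (n - i%:Z)); apply: (mulIg (s ^+ i)%g).
by rewrite -zexpD subrK.
Qed.

End Witness.

Lemma sum_mul_Complex (R : realType) (I : Type) (l : seq I) (a b c d : I -> R) :
  \sum_(i <- l) (a i +i* b i)%C * (c i +i* d i)%C =
  ((\sum_(i <- l) c i * a i - \sum_(i <- l) d i * b i)%R +i*
   (\sum_(i <- l) c i * b i + \sum_(i <- l) d i * a i)%R)%C :> Cplx R.
Proof.
rewrite -sumrB -big_split/=; elim: l => [|i l IH]; first by rewrite !big_nil.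
rewrite !big_cons IH ![c i * _]mulrC ![d i * _]mulrC [b i * c i + _]addrC.
by [].
Qed.

Lemma zsumN (R : realType) L (F : int -> R) : zsum L (fun n => F (- n)) = zsum L F.
Proof.
rewrite /zsum [LHS](reindex_inj rev_ord_inj)/=; apply: eq_bigr => i _; congr F.
by have := ltn_ord i; lia.
Qed.

(** Torsion-freeness makes the powers of s a copy of Z, to which f1 + i f2 and T1 + i T2 from
    [malliavin] are transplanted, constant along X. *)
Lemma fixed_point_not_self_adjoint (R : realType) (G : groupType) (X : topologicalType)
    (sigma : G -> X -> X) (s : G) (x0 : X) :
  compact [set: X] -> acts_by_homeomorphisms sigma ->
  abelian_group G -> torsion_free G -> s <> 1%g -> sigma s x0 = x0 ->
  exists I : set (G -> X -> Cplx R), [/\ ideal sigma I, l1_closed I & ~ self_adjoint sigma I].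
Proof.
move=> cX act abG tf s1 fix_s.
have s_inj := zexp_inj tf s1.
have s_inf : injective (fun i : nat => s ^+ i)%g.
  by move=> i j e; have [] : Posz i = Posz j by exact: s_inj.
have [f1 [f2 [A [K [L [T1 [T2 [fA TK Tsym H0 [J1 H8]]]]]]]]] := malliavin R.
pose T J n : Cplx R := (T1 J n +i* T2 J n)%C.
pose z n : Cplx R := (f1 n +i* f2 n)%C.
have TK' J n : nrm (T J n) <= K + K.
  by apply: le_trans (nrm_le_ReIm _) _; have [h1 h2] := TK J n; exact: lerD.
have zA N : zsum N (fun n => nrm (z n)) <= A + A.
  apply: (@le_trans _ _ (zsum N (fun n => `|f1 n| + `|f2 n|))).
    by apply: ler_zsum => n; exact: nrm_le_ReIm.
  by rewrite zsumD; have [h1 h2] := fA N; exact: lerD.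
exists (annihilator sigma s x0 L T); split.
- exact: (annihilator_ideal cX act abG fix_s L TK').
- exact: (annihilator_closed cX TK' s_inf).
move=> sa; have : annihilator sigma s x0 L T (@zfun R G X s z).
  split; first exact: ell1_zfun zA.
  move=> e e0; have [J0 HJ] := H0 _ (divr_gt0 e0 (ltr0n _ 2)); exists J0 => J /HJ {}HJ r t.
  have [[k ->]|rk] := pselect (exists k, r = zexp s k); last first.
    by rewrite pair_zfun0 ?nrm0 ?(ltW e0)// => k rE; apply: rk; exists k.
  have [h1 h2] := HJ (k + (L J)%:Z).
  apply: le_trans (nrm_le_ReIm _) _; rewrite pair_zfun// (splitr e).
  set k' := k + _ in h1 h2 *.
  rewrite (sum_mul_Complex _ (fun i : 'I_(2 * L J).+1 => T1 J (i%:Z - (L J)%:Z))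
    (fun i => T2 J (i%:Z - (L J)%:Z)) (fun i => f1 (i%:Z - (L J)%:Z + k'))
    (fun i => f2 (i%:Z - (L J)%:Z + k'))).
  exact: lerD h1 h2.
move=> /sa[_ /(_ 1 ltr01)[J0 HJ]].
(* This r undoes the shift built into [pair], so that T_J meets the adjoint without translation: the
   result is at most 1, while its real part is at least 8. *)
have := HJ (maxn J0 J1) (leq_maxl _ _) (zexp s (- (L (maxn J0 J1))%:Z)) 1%g.
have := H8 (maxn J0 J1) (leq_maxr _ _); set J := maxn J0 J1.
set p := pair _ _ _ _ _ _ _ => h8 h1.
suff pE : complex.Re p = zsum (L J) (fun n => f1 n * T1 J n) + zsum (L J) (fun n => f2 n * T2 J n).
  have := Re_le_nrm p; rewrite pE => /le_trans/(_ h1)/(le_trans (ler_norm _))/(le_trans h8).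
  by rewrite leNgt ltr1n.
have -> : p = \sum_(i < (2 * L J).+1)
    (T1 J (i%:Z - (L J)%:Z) +i* T2 J (i%:Z - (L J)%:Z))%C *
    (f1 (- (i%:Z - (L J)%:Z)) +i* - f2 (- (i%:Z - (L J)%:Z)))%C :> Cplx R.
  rewrite /p /pair; apply: eq_bigr => i _; congr (_ * _).
  by rewrite -zexpD addrC /l1_star /translate -zexpN zfunE.
rewrite sum_mul_Complex [complex.Re _]/= -sumrN.
(* The adjoint takes f at -n; reflecting the window and using that T1 and T2 are even gives back f
   at n. *)
rewrite -[X in _ = X + _]zsumN -[X in _ = _ + X]zsumN; congr (_ + _); apply: eq_bigr => i _.
  by have [-> _] := Tsym J (i%:Z - (L J)%:Z).
by have [_ ->] := Tsym J (i%:Z - (L J)%:Z); rewrite mulNr opprK.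
Qed.


Theorem theorem1 (R : realType) (G : groupType) (X : topologicalType)
    (sigma : G -> X -> X) :
  abelian_group G -> torsion_free G ->
  countable [set: G] -> infinite_set [set: G] ->
  compact [set: X] -> hausdorff_space X ->
  acts_by_homeomorphisms sigma ->
  free_action sigma <->
  (forall I : set (G -> X -> Cplx R),
     ideal sigma I -> l1_closed I -> self_adjoint sigma I).
Proof.
move=> abG tf _ _ cX hX act; split=> [free I idI clI|sa s s1 x fix_s].
  exact: (closed_ideal_self_adjoint cX hX act free idI clI).
have [I [idI clI nsa]] := fixed_point_not_self_adjoint R cX act abG tf s1 fix_s.
by apply: nsa; exact: sa.
Qed.
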